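(* Let $\varphi:[0,\infty)\to(0,\infty)$ be decreasing, regularly varying of index $-1$, and satisfy property (W1): there is a constant $C_1>0$ such that $C_1t^2\varphi(t)\le\varphi^{-1}\left(\frac1t\right)$ for all sufficiently large $t$. Let $V\in\mathcal{L}_\varphi(\mathcal{H})$ be strictly positive. Whenever $G\in\mathbb{B}(\mathcal{H})$ is spectrally $\varphi$-modulated with respect to $V$, $G$ is weakly $\varphi$-modulated with respect to $V$.
   Context: $\mathcal{H}$ is a separable Hilbert space. $\varphi$ is regularly varying of index $-1$ if it is measurable and $\lim_{t\to\infty}\varphi(\lambda t)/\varphi(t)=\lambda^{-1}$ for all $\lambda>0$. $\varphi^{-1}$ denotes the inverse function of $\varphi$ ($\varphi$ is tacitly invertible, so that $\varphi^{-1}(1/t)$ is defined for large $t$). $\mu(n,A)$, $n\ge0$, denote the singular values of a compact operator in decreasing order; $\mathcal{L}_\varphi=\{A\text{ compact}:\sup_{n\ge0}\mu(n,A)/\varphi(n)<\infty\}$; $\mathcal{L}_\varphi^{(q)}=\{A:|A|^q\in\mathcal{L}_\varphi\}$ for $0<q<\infty$ and $\mathcal{L}_\varphi^{(\infty)}=\mathbb{B}(\mathcal{H})$. $V\in\mathbb{B}(\mathcal{H})$ is strictly positive if it is positive with dense range; $E_V$ is its spectral measure and $\|\cdot\|_2$ is the Hilbert–Schmidt norm. $G$ is spectrally $\varphi$-modulated with respect to $V$ if $\sup_{t>0}\frac{\|GE_V[0,t^{-1}]\|_2}{\sqrt{\varphi(t)}}<\infty$. $G$ is weakly $\varphi$-modulated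 with respect to $V$ if there is $p\ge1$ such that the densely defined operator $GV^{-1/p}$ extends to a bounded operator belonging to $\mathcal{L}_\varphi^{(p/(p-1))}(\mathcal{H})$ (exponent $\infty$ if $p=1$). *)

(* Defs.v *)
(* Operators are total maps [{linear H -> H}], where [H] is a complete normed
   space over [R[i]] whose norm comes from the inner product [ip] (linear in
   the first variable, conjugate-linear in the second). *)
From HB Require Import structures.
From mathcomp Require Import all_boot all_order all_algebra.
From mathcomp Require Import sesquilinear complex.
From mathcomp Require Import all_classical all_reals all_analysis.

Set Implicit Arguments.
Unset Strict Implicit.
Unset Printing Implicit Defensive.

Import Order.TTheory GRing.Theory Num.Theory.
Import numFieldNormedType.Exports.

Local Open Scope classical_set_scope.
Local Open Scope ring_scope.
Local Open Scope complex_scope.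

Section RegularVariation.
Context {R : realType}.
Implicit Type phi : R -> R.

Definition regularly_varying (rho : R) phi :=
  measurable_fun (`[0, +oo[ : set R) phi /\
  forall l, 0 < l -> phi (l * t) / phi t @[t --> +oo] --> l `^ rho.

(* What is needed for [phi^-1 (1/t)] to make sense for all large [t]. *)
Definition invertible_near0 phi :=
  \forall s \near 0^'+, exists! x, 0 <= x /\ phi x = s.

Definition phi_inv phi (s : R) : R := xget 0 [set x | 0 <= x /\ phi x = s].

Definition property_W1 phi :=
  exists2 C1 : R, 0 < C1 &
    \forall t \near +oo, C1 * t ^+ 2 * phi t <= phi_inv phi (t^-1).

End RegularVariation.

Definition separable_space (T : topologicalType) :=
  exists2 D : set T, countable D & dense D.

Section Operators.
Context {R : realType} {H : completeNormedModType R[i]}.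
Variable ip : {dot H for @Num.conj R[i]}.
Implicit Types (A B V G : {linear H -> H}) (phi : R -> R).

Definition inner_product_norm := forall x : H, `|x| ^+ 2 = ip x x.

Definition bounded_op A := exists M : R, forall x, `|A x| <= M%:C * `|x|.

Definition compact_op A := precompact (A @` [set x | `|x| <= 1]).

Definition positive_op A := forall x, 0 <= ip (A x) x.

Definition strictly_positive A :=
  [/\ bounded_op A, positive_op A & dense (range A)].

Definition is_adjoint A B := forall x y, ip (A x) y = ip x (B y).

Definition is_modulus A (T : {linear H -> H}) :=
  [/\ bounded_op T, positive_op T &
      exists2 B, is_adjoint A B & forall x, T (T x) = B (A x)].

Definition has_dim (W : set H) (d : nat) := exists b : 'I_d -> H,
  (forall c : 'I_d -> R[i], \sum_i c i *: b i = 0 -> forall i, c i = 0) /\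
  (forall x, W x <-> exists c : 'I_d -> R[i], x = \sum_i c i *: b i).

(* [s] lists the eigenvalues of [|A|] in decreasing order: each [l > 0] occurs
   in [s] as often as the dimension of [ker (|A| - l)], and [s] is padded with
   zeros if [|A|] has finite rank.  For compact [A] this determines [s]. *)
Definition is_singular_values A (s : nat -> R) :=
  [/\ forall n, 0 <= s n, nonincreasing_seq s &
      exists2 T, is_modulus A T &
        forall l : R, 0 < l -> exists2 d : nat,
          has_dim [set x | T x = l%:C *: x] d & ([set n | s n = l] #= `I_d)%card].

Definition in_L phi A :=
  compact_op A /\ exists2 s, is_singular_values A s &
    has_ubound (range (fun n : nat => s n / phi n%:R)).

Definition orthogonal_projection A :=
  [/\ bounded_op A, forall x, A (A x) = A x & is_adjoint A A].

Definition projection_valued_measure (E : set R -> {linear H -> H}) :=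
  [/\ forall X, measurable X -> orthogonal_projection (E X),
      forall x, E setT x = x,
      forall X Y, measurable X -> measurable Y ->
        forall x, E (X `&` Y) x = E X (E Y x) &
      forall F : (set R)^nat, (forall n, measurable (F n)) -> trivIset setT F ->
        forall x, \sum_(0 <= i < n) E (F i) x @[n --> \oo]
                  --> E (\bigcup_n F n) x].

Definition spectral_distr (E : set R -> {linear H -> H}) (x : H) :
  set R -> \bar R := fun X => (complex.Re (ip (E X x) x))%:E.

(* The bounded operator [T] is the integral of [f] with respect to [E], in the
   weak sense; the diagonal values [ip (T x) x] determine [T] by polarization. *)
Definition is_spectral_integral (E : set R -> {linear H -> H}) (f : R -> R)
    (T : {linear H -> H}) :=
  bounded_op T /\ forall x,
    (spectral_distr E x).-integrable setT (EFin \o f) /\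
    ip (T x) x = (fine (\int[spectral_distr E x]_l (f l)%:E))%:C.

(* Bounded self-adjoint operators have exactly one spectral measure, so choosing
   [E] existentially below loses nothing. *)
Definition is_spectral_measure A (E : set R -> {linear H -> H}) :=
  projection_valued_measure E /\ is_spectral_integral E id A.

(* [T = A ^ r], for a positive operator [A] and [r > 0]. *)
Definition is_op_power A (r : R) (T : {linear H -> H}) :=
  exists2 E, is_spectral_measure A E &
    is_spectral_integral E (fun l => l `^ r) T.

Definition in_Lpow phi (q : \bar R) A :=
  bounded_op A /\
  match q with
  | r%:E => exists T P, [/\ is_modulus A T, is_op_power T r P & in_L phi P]
  | +oo%E => True
  | -oo%E => False
  end.

Definition orthonormal_basis (B : set H) :=
  [/\ forall e, B e -> ip e e = 1,
      forall e f, B e -> B f -> e <> f -> ip e f = 0 &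
      forall x, (forall e, B e -> ip x e = 0) -> x = 0].

(* The Hilbert-Schmidt norm; the sum does not depend on the orthonormal basis,
   so the supremum is that of a singleton. *)
Definition hs_norm (A : H -> H) : \bar R :=
  ereal_sup [set sqrte (\esum_(e in B) (complex.Re `|A e| ^+ 2)%:E)
            | B in orthonormal_basis].

Definition spectrally_modulated phi V G :=
  exists2 E, is_spectral_measure V E &
    (ereal_sup [set (hs_norm (G \o E `[0%R, (t^-1)%R]%classic) *
                    ((Num.sqrt (phi t))^-1)%:E)%E
               | t in (`]0%R, +oo[%classic : set R)] < +oo)%E.

Definition conjugate_exponent (p : R) : \bar R :=
  if p == 1 then +oo%E else (p / (p - 1))%:E.

(* [W] is [V ^ (1/p)], so [V ^ (-1/p)] is the inverse of [W], defined on the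
   range of [W]: [B] extends [G V ^ (-1/p)]. *)
Definition weakly_modulated phi V G :=
  exists2 p : R, 1 <= p &
    exists W B, [/\ is_op_power V p^-1 W,
                    forall x y, W x = y -> B y = G x &
                    in_Lpow phi (conjugate_exponent p) B].

End Operators.

(* Main.v *)
Require Import Defs.
From HB Require Import structures.
From mathcomp Require Import all_boot all_order all_algebra.
From mathcomp Require Import sesquilinear complex.
From mathcomp Require Import all_classical all_reals all_analysis.
From mathcomp Require Import finmap zify ring lra measurable_realfun.
Set Implicit Arguments.
Unset Strict Implicit.
Unset Printing Implicit Defensive.
Import Order.TTheory GRing.Theory Num.Theory.
Import numFieldNormedType.Exports.
Local Open Scope classical_set_scope.
Local Open Scope ring_scope.
Local Open Scope complex_scope.

(** Weak modulation holds with [p = 4], that is, [G V^(-1/4)] extends to an operator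
    [B] with [|B|^(4/3)] in [L_phi].

    The operator [V] is compact and positive, so it has an orthonormal eigenbasis
    [e k] with eigenvalues [v k] decreasing to [0]
    ([compact_positive_diagonal]), and [V] in [L_phi] gives [v k <= K phi k]
    ([eigenvalue_le_singular_value]). If [v k < 1/t], the projection [E [0, 1/t]]
    fixes [e k] ([spectral_subspace_eigenvector]); evaluating the Hilbert-Schmidt norm
    in this basis, spectral modulation becomes: the sum of the [|G (e k)|^2] with
    [v k < 1/t] is at most [C phi t] ([spectrally_modulated_eigenbasis]).

    Put [g k = v k^(-1/4) G (e k)]. A dyadic decomposition of the range of [v] and the
    decay of [phi] along [2^j t] bound the sum of the [|g k|^2] with [v k < s] by a
    multiple of [phi (1/s) s^(-1/2)] ([dyadic_tail]). So [B x = sum_k <x, e k> g k]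
    is a Hilbert-Schmidt operator, and [B V^(1/4) = G]. With [s = 2 K phi n] the sum
    over [k >= n] is covered, and the condition on [phi_inv] at [t = 1 / phi n], where
    [phi_inv (1/t) = n], reads [phi (1 / phi n) <= n (phi n)^2 / C1]
    ([W1_composition]). The sum over [k >= n] of [|g k|^2] is thus at most
    [c n (phi n)^(3/2)] ([weighted_tail]).

    This sum is the squared Hilbert-Schmidt norm of [B] minus an operator of rank at most
    [n], so it bounds [n] times the eigenvalue of index [2 n - 1] of [B^* B]
    ([singular_value_tail_bound]). These eigenvalues are therefore
    [O((phi n)^(3/2))], and the singular values of [|B|^(4/3)], which are their powers
    of exponent [2/3], are [O(phi n)] ([hilbert_schmidt_in_Lpow]).

    The powers of [V] and of [|B|] are diagonal in an eigenbasis, and are defined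
    through a spectral measure; [diag_op_power] provides it by letting [E X] multiply
    the coefficient of index [k] by the indicator of [X] at the eigenvalue. *)

(** * Real-valued norms *)

Local Notation cj := (@Num.conj _).

Section RealNorm.
Context {R : realType}.

(** Norms over [R[i]] take their values in [R[i]]; the real-valued norm allows
    comparison with [phi] and reasoning in an ordered field. *)
Definition rnorm {V : normedZmodType R[i]} (x : V) : R := complex.Re `|x|.

Context {V : normedZmodType R[i]}.
Implicit Types x y : V.

Lemma rnormE x : `|x| = (rnorm x)%:C.
Proof. by rewrite /rnorm RRe_real// normr_real. Qed.

Lemma rnorm_ge0 x : 0 <= rnorm x.
Proof. by rewrite -ler0c -rnormE. Qed.

Lemma rnorm0 : rnorm (0 : V) = 0.
Proof. by rewrite /rnorm normr0. Qed.

Lemma rnorm_eq0 x : rnorm x = 0 -> x = 0.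
Proof. by move=> h; apply/eqP; rewrite -normr_eq0 rnormE h. Qed.

Lemma rnormN x : rnorm (- x) = rnorm x.
Proof. by rewrite /rnorm normrN. Qed.

Lemma rdistC x y : rnorm (x - y) = rnorm (y - x).
Proof. by rewrite /rnorm distrC. Qed.

Lemma ler_rnormD x y : rnorm (x + y) <= rnorm x + rnorm y.
Proof. by rewrite -lecR rmorphD/= -!rnormE ler_normD. Qed.

Lemma ler_rnormB x y : rnorm (x - y) <= rnorm x + rnorm y.
Proof. by rewrite -(rnormN y) ler_rnormD. Qed.

Lemma rnorm_small x : (forall e : R, 0 < e -> rnorm x <= e) -> x = 0.
Proof.
by move=> h; apply/rnorm_eq0/le_anti; rewrite rnorm_ge0 andbT; apply/ler_addgt0Pl => e /h; rewrite addr0.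
Qed.

End RealNorm.

Section RealNormScalars.
Context {R : realType}.
Implicit Types (z w : R[i]).

Lemma rcD (a b : R) : (a + b)%:C = a%:C + b%:C. Proof. exact: rmorphD. Qed.
Lemma rcB (a b : R) : (a - b)%:C = a%:C - b%:C. Proof. exact: rmorphB. Qed.
Lemma rcN (a : R) : (- a)%:C = - a%:C. Proof. exact: rmorphN. Qed.
Lemma rcM (a b : R) : (a * b)%:C = a%:C * b%:C. Proof. exact: rmorphM. Qed.
Lemma rcV (a : R) : (a^-1)%:C = a%:C^-1. Proof. exact: fmorphV. Qed.
Lemma rcX (a : R) n : (a ^+ n)%:C = a%:C ^+ n. Proof. exact: rmorphXn. Qed.
Lemma rc_sum I (r : seq I) P (F : I -> R) :
  (\sum_(i <- r | P i) F i)%:C = \sum_(i <- r | P i) (F i)%:C.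
Proof. exact: rmorph_sum. Qed.

Lemma cjM z w : cj (z * w) = cj z * cj w. Proof. exact: rmorphM. Qed.
Lemma cjN z : cj (- z) = - cj z. Proof. exact: rmorphN. Qed.
Lemma cjV z : cj z^-1 = (cj z)^-1. Proof. exact: fmorphV. Qed.
Lemma cjR (a : R) : cj a%:C = a%:C. Proof. exact: conjc_real. Qed.
Lemma cj_addE z : 2%:R * (complex.Re z)%:C = z + cj z. Proof. by rewrite -addcJ. Qed.
Lemma rnormM z w : rnorm (z * w) = rnorm z * rnorm w.
Proof. by apply: complexI; rewrite rmorphM/= -!rnormE normrM. Qed.

Lemma rnormZ {V : normedModType R[i]} z (x : V) : rnorm (z *: x) = rnorm z * rnorm x.
Proof. by apply: complexI; rewrite rmorphM/= -!rnormE normrZ. Qed.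

Lemma rnormR (a : R) : rnorm a%:C = `|a|.
Proof. by rewrite /rnorm normc_def/= expr0n/= addr0 sqrtr_sqr. Qed.

Lemma rnorm_conj z : rnorm (cj z) = rnorm z.
Proof. by rewrite /rnorm normcJ. Qed.

Lemma rnorm_sqrE z : (rnorm z ^+ 2)%:C = z * cj z.
Proof. by rewrite rmorphXn/= -rnormE sqr_normc. Qed.

Lemma ler_Re_rnorm z : complex.Re z <= rnorm z.
Proof.
apply: (le_trans (ler_norm _)).
by rewrite -lecR -rnormE normc_ge_Re.
Qed.

End RealNormScalars.

(** * Inner product *)

Section InnerProduct.
Context {R : realType} {H : completeNormedModType R[i]}.
Variable ip : {dot H for @Num.conj R[i]}.
Implicit Types (x y : H) (a : R[i]).

Lemma ipC x y : ip x y = cj (ip y x).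
Proof. by rewrite (hermC ip) /= expr0 mul1r. Qed.

Lemma ipDl x y z : ip (x + y) z = ip x z + ip y z.
Proof. by rewrite linearDl. Qed.

Lemma ipDr x y z : ip z (x + y) = ip z x + ip z y.
Proof. by rewrite linearDr. Qed.

Lemma ipZl a x z : ip (a *: x) z = a * ip x z.
Proof. by rewrite linearZl_LR. Qed.

Lemma ipZr a x z : ip z (a *: x) = cj a * ip z x.
Proof. by rewrite linearZr_LR. Qed.

Lemma ipNl x z : ip (- x) z = - ip x z.
Proof. by rewrite linearNl. Qed.
Lemma ipNr x z : ip z (- x) = - ip z x.
Proof. by rewrite linearNr. Qed.
Lemma ipBl x y z : ip (x - y) z = ip x z - ip y z.
Proof. by rewrite linearBl. Qed.
Lemma ipBr x y z : ip z (x - y) = ip z x - ip z y.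
Proof. by rewrite linearBr. Qed.
Lemma ip0l z : ip 0 z = 0.
Proof. by rewrite linear0l. Qed.
Lemma ip0r z : ip z 0 = 0.
Proof. by rewrite linear0r. Qed.

Lemma ip_suml I (r : seq I) P (F : I -> H) z :
  ip (\sum_(i <- r | P i) F i) z = \sum_(i <- r | P i) ip (F i) z.
Proof. by rewrite linear_sumlz. Qed.

Lemma ip_sumr I (r : seq I) P (F : I -> H) z :
  ip z (\sum_(i <- r | P i) F i) = \sum_(i <- r | P i) ip z (F i).
Proof. by rewrite linear_sumr. Qed.

Hypothesis ip_norm : inner_product_norm ip.

Lemma ip_rnorm x : ip x x = (rnorm x ^+ 2)%:C.
Proof. by rewrite -ip_norm rnormE rmorphXn. Qed.

Lemma ip_eq0 x : ip x x = 0 -> x = 0.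
Proof.
rewrite ip_rnorm => /complexI/eqP; rewrite sqrf_eq0 => /eqP; exact: rnorm_eq0.
Qed.

Lemma rnormD_sqr x y :
  rnorm (x + y) ^+ 2 = rnorm x ^+ 2 + rnorm y ^+ 2 + 2 * complex.Re (ip x y).
Proof.
apply: complexI; rewrite -ip_rnorm !rmorphD/= -!ip_rnorm ipDl !ipDr (ipC y x).
rewrite rmorphM/= [2%:C](_ : _ = 2%:R); last by rewrite rmorph_nat.
rewrite cj_addE; ring.
Qed.

(** The real number [t = - |y|^(-2)] minimizes [|x + t <x,y> y|^2], which is
    nonnegative. *)
Lemma cauchy_schwarz x y : rnorm (ip x y) <= rnorm x * rnorm y.
Proof.
rewrite -(@ler_pXn2r _ 2)// ?nnegrE ?mulr_ge0 ?rnorm_ge0// exprMn.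
have [->|y0] := eqVneq y 0; first by rewrite ip0r !rnorm0 expr0n/= mulr0.
set p := ip x y.
have ypos : 0 < rnorm y ^+ 2.
  rewrite exprn_even_gt0//=; apply: contra_neq y0; exact: rnorm_eq0.
have := sqr_ge0 (rnorm (x + (- p / (rnorm y ^+ 2)%:C) *: y)).
rewrite rnormD_sqr rnormZ exprMn ipZr -/p.
have -> : cj (- p / (rnorm y ^+ 2)%:C) * p = (- (rnorm p ^+ 2 / rnorm y ^+ 2))%:C.
  by rewrite rcN rcM rcV rnorm_sqrE cjM cjN cjV cjR; ring.
rewrite /= rnormM rnormN -fmorphV/= rnormR ger0_norm ?invr_ge0 ?sqr_ge0// exprMn.
have -> : rnorm p ^+ 2 * (rnorm y ^+ 2)^-1 ^+ 2 * rnorm y ^+ 2 = rnorm p ^+ 2 / rnorm y ^+ 2.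
  by rewrite -mulrA [X in _ * (X * _)]expr2 mulfVK ?gt_eqF.
rewrite mulrN => h; rewrite -ler_pdivrMr//; lra.
Qed.

End InnerProduct.

(** * Series in Hilbert space *)

Section Limits.
Context {R : realType} {H : completeNormedModType R[i]}.

Lemma cvg_rnormP {T} {F : set_system T} {FF : Filter F} (u : T -> H) (x : H) :
  u @ F --> x <-> forall e : R, 0 < e -> \forall n \near F, rnorm (x - u n) < e.
Proof.
rewrite cvgrPdist_lt; split=> h e e0.
  have := h e%:C; rewrite ltcR => /(_ e0); apply: filterS => n /=.
  by rewrite rnormE ltcR.
have e0' : 0 < complex.Re e by move: e0; rewrite ltcE /= => /andP[].
have eE : e = (complex.Re e)%:C by rewrite RRe_real// gtr0_real.
by apply: filterS (h _ e0') => n; rewrite eE rnormE ltcR.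
Qed.

Lemma cvg_uniqueH (u : nat -> H) (x y : H) : u @ \oo --> x -> u @ \oo --> y -> x = y.
Proof. by move=> ux uy; apply: (cvg_unique _ ux uy); exact: norm_hausdorff. Qed.

Lemma bounded_opP (A : {linear H -> H}) : bounded_op A ->
  exists2 M : R, 0 <= M & forall x, rnorm (A x) <= M * rnorm x.
Proof.
move=> [M AM]; exists `|M| => // x.
apply: (@le_trans _ _ (M * rnorm x)).
  by rewrite -lecR rcM -!rnormE.
by rewrite ler_wpM2r ?rnorm_ge0 ?ler_norm.
Qed.

Lemma bounded_op_of (A : {linear H -> H}) (M : R) :
  (forall x, rnorm (A x) <= M * rnorm x) -> bounded_op A.
Proof. by move=> h; exists M => x; rewrite !rnormE -rcM lecR. Qed.

Lemma cvg_bounded_op (A : {linear H -> H}) (u : nat -> H) x :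
  bounded_op A -> u @ \oo --> x -> A \o u @ \oo --> A x.
Proof.
move=> /bounded_opP[M M0 AM] /cvg_rnormP ux; apply/cvg_rnormP => e e0.
have eM : 0 < e / (M + 1) by rewrite divr_gt0// ltr_wpDl.
apply: filterS (ux _ eM) => n; rewrite ltr_pdivlMr ?ltr_wpDl// => h.
rewrite /= -linearB; apply: le_lt_trans h; apply: (le_trans (AM _)).
by rewrite mulrC ler_wpM2l ?rnorm_ge0// lerDl.
Qed.

Lemma cvg_rnorm (u : nat -> H) x : u @ \oo --> x -> rnorm (u n) @[n --> \oo] --> rnorm x.
Proof.
move=> /cvg_rnormP ux; apply/cvgrPdist_lt => e e0.
apply: filterS (ux e e0) => n; apply: le_lt_trans.
rewrite ler_norml; apply/andP; split; last first.
  by rewrite lerBlDr (le_trans _ (ler_rnormD _ _))// subrK.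
rewrite lerNl opprB lerBlDr rdistC (le_trans _ (ler_rnormD _ _))// subrK//.
Qed.

Variable ip : {dot H for @Num.conj R[i]}.
Hypothesis ip_norm : inner_product_norm ip.

Lemma cvg_ip_eq (u v : nat -> H) a b x y :
  u @ \oo --> a -> v @ \oo --> b -> (forall n, ip (u n) y = ip x (v n)) ->
  ip a y = ip x b.
Proof.
move=> /cvg_rnormP ua /cvg_rnormP vb uv; apply/subr0_eq/rnorm_small => e e0.
pose c := rnorm x + rnorm y + 1.
have c0 : 0 < c by rewrite ltr_wpDl// addr_ge0 ?rnorm_ge0.
have ec : 0 < e / c by rewrite divr_gt0.
have [n [un vn]] := filter_ex (filterI (ua _ ec) (vb _ ec)).
have -> : ip a y - ip x b = ip (a - u n) y - ip x (b - v n).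
  by rewrite ipBl ipBr uv; ring.
apply: (le_trans (ler_rnormB _ _)).
apply: (@le_trans _ _ (e / c * rnorm y + rnorm x * (e / c))).
  apply: lerD; apply: (le_trans (cauchy_schwarz ip_norm _ _)).
    by rewrite ler_wpM2r ?rnorm_ge0 ?ltW.
  by rewrite ler_wpM2l ?rnorm_ge0 ?ltW.
rewrite [_ * (e / c)]mulrC -mulrDr -mulrA ler_piMr ?ltW//.
by rewrite mulrC ltr_pdivrMr// mul1r /c; lra.
Qed.

Lemma cvg_Re_ip (u : nat -> H) a y :
  u @ \oo --> a -> complex.Re (ip (u n) y) @[n --> \oo] --> complex.Re (ip a y).
Proof.
move=> /cvg_rnormP ua; apply/cvgrPdist_lt => e e0.
have c0 : 0 < rnorm y + 1 by rewrite ltr_wpDl ?rnorm_ge0.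
have ec : 0 < e / (rnorm y + 1) by rewrite divr_gt0.
apply: filterS (ua _ ec) => n; rewrite ltr_pdivlMr// => h.
have -> : complex.Re (ip a y) - complex.Re (ip (u n) y) = complex.Re (ip (a - u n) y).
  by rewrite ipBl raddfB.
have h2 := cauchy_schwarz ip_norm (a - u n) y.
have h3 := ler_Re_rnorm (ip (a - u n) y).
have := ler_Re_rnorm (- ip (a - u n) y); rewrite rnormN raddfN/= => h4.
by rewrite ltr_norml; have := rnorm_ge0 (a - u n); lra.
Qed.

End Limits.

Section Bessel.
Context {R : realType} {H : completeNormedModType R[i]}.
Variable ip : {dot H for @Num.conj R[i]}.
Hypothesis ip_norm : inner_product_norm ip.
Implicit Types (h e : nat -> H) (M : R).

(** Boundedness of the synthesis map [c |-> sum_k c_k h_k] on [l^2]; by duality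
    (lemma [bessel_coef]) it is Bessel's inequality with constant [M]. *)
Definition bessel M h := 0 <= M /\ forall (c : nat -> R[i]) n m,
  rnorm (\sum_(n <= k < m) c k *: h k) ^+ 2 <=
  M * \sum_(n <= k < m) rnorm (c k) ^+ 2.

(** Duality: pair [x] with [sum_k <x, h k> h k]. *)
Lemma bessel_coef M h x n m : bessel M h ->
  \sum_(n <= k < m) rnorm (ip x (h k)) ^+ 2 <= M * rnorm x ^+ 2.
Proof.
move=> [M0 hM]; set s := (X in X <= _).
have s0 : 0 <= s by apply: sumr_ge0 => k _; exact: sqr_ge0.
pose y := \sum_(n <= k < m) ip x (h k) *: h k.
have yx : rnorm (ip x y) = s.
  rewrite /y ip_sumr -(ger0_norm s0) -rnormR /s rc_sum.
  congr rnorm; apply: eq_bigr => k _.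
  by rewrite rnorm_sqrE ipZr mulrC.
have : s ^+ 2 <= rnorm x ^+ 2 * (M * s).
  apply: (@le_trans _ _ (rnorm x ^+ 2 * rnorm y ^+ 2)); last first.
    by rewrite ler_wpM2l ?sqr_ge0// hM.
  rewrite -exprMn ler_sqr ?nnegrE// ?mulr_ge0 ?rnorm_ge0// -{1}yx.
  exact: cauchy_schwarz.
have [->|sn0] := eqVneq s 0; first by rewrite mulr_ge0 ?sqr_ge0.
by rewrite expr2 mulrA ler_pM2r ?[M * _]mulrC// lt_neqAle eq_sym sn0.
Qed.

(** Triangle inequality followed by the Cauchy-Schwarz inequality for the
    coefficients, by induction on the number of terms. *)
Lemma rnorm_sum_pair (h : nat -> H) (c : nat -> R[i]) n m :
  rnorm (\sum_(n <= k < m) c k *: h k) ^+ 2 <=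
  (\sum_(n <= k < m) rnorm (h k) ^+ 2) * \sum_(n <= k < m) rnorm (c k) ^+ 2.
Proof.
elim: m => [|m IH].
  by rewrite !big_geq// rnorm0 expr0n/= mul0r.
have [mn|nm] := ltnP m n; first by rewrite !big_geq// rnorm0 expr0n/= mul0r.
rewrite !big_nat_recr//=.
set P := (\sum_(n <= k < m) rnorm (h k) ^+ 2) in IH *.
set Q := (\sum_(n <= k < m) rnorm (c k) ^+ 2) in IH *.
set S := \sum_(n <= k < m) c k *: h k in IH *.
have P0 : 0 <= P by apply: sumr_ge0 => k _; exact: sqr_ge0.
have Q0 : 0 <= Q by apply: sumr_ge0 => k _; exact: sqr_ge0.
have := ler_rnormD S (c m *: h m); rewrite rnormZ.
have := rnorm_ge0 (S + c m *: h m); have := rnorm_ge0 S.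
have := rnorm_ge0 (c m); have := rnorm_ge0 (h m); move: IH.
move: (rnorm (S + _)) (rnorm S) (rnorm (c m)) (rnorm (h m)) => t s a b IH b0 a0 s0 t0 ts.
(* arithmetic-geometric mean inequality, as [s ^+ 2 <= P * Q] *)
have key : 2 * s * (a * b) <= P * a ^+ 2 + Q * b ^+ 2.
  rewrite -(@ler_pXn2r _ 2)// ?nnegrE; [|by rewrite !mulr_ge0|by rewrite addr_ge0 ?mulr_ge0 ?sqr_ge0].
  apply: (@le_trans _ _ (4 * (P * Q) * (a * b) ^+ 2)).
    have -> : (2 * s * (a * b)) ^+ 2 = 4 * s ^+ 2 * (a * b) ^+ 2 by ring.
    by rewrite ler_wpM2r ?sqr_ge0// ler_wpM2l.
  have := sqr_ge0 (P * a ^+ 2 - Q * b ^+ 2); nra.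
have : t ^+ 2 <= (s + a * b) ^+ 2.
  by rewrite ler_sqr ?nnegrE// addr_ge0 ?mulr_ge0.
have -> : (s + a * b) ^+ 2 = s ^+ 2 + 2 * s * (a * b) + b ^+ 2 * a ^+ 2 by ring.
have -> : (P + b ^+ 2) * (Q + a ^+ 2) = P * Q + (P * a ^+ 2 + Q * b ^+ 2) + b ^+ 2 * a ^+ 2.
  by ring.
lra.
Qed.

Lemma bessel_square_summable M h :
  (forall n, \sum_(0 <= k < n) rnorm (h k) ^+ 2 <= M) -> bessel M h.
Proof.
move=> hM; split; first by have := hM 0%N; rewrite big_geq.
move=> c n m; apply: (le_trans (rnorm_sum_pair _ _ _ _)).
rewrite ler_wpM2r ?sumr_ge0// => [k _|]; first exact: sqr_ge0.
apply: le_trans (hM m); have [nm|/ltnW mn] := leqP n m; last first.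
  by rewrite big_geq// sumr_ge0// => k _; exact: sqr_ge0.
rewrite [leRHS](@big_cat_nat _ _ _ n)//= lerDr sumr_ge0// => k _; exact: sqr_ge0.
Qed.

Lemma square_summable_cauchy (c : nat -> R) M :
  (forall k, 0 <= c k) -> (forall n, \sum_(0 <= k < n) c k <= M) ->
  forall e : R, 0 < e -> \forall n \near (\oo, \oo), \sum_(n.1 <= k < n.2) c k < e.
Proof.
move=> c0 cM e e0.
have : cvgn (series c).
  apply: nondecreasing_is_cvgn.
    by apply/nondecreasing_seqP => n; rewrite /series/= big_nat_recr//= lerDl.
  by exists M => _ [n _ <-]; exact: cM.
move=> /cauchy_cvgP/cauchy_seriesP/(_ e e0); apply: filterS => -[n m]/=.
by rewrite ger0_norm ?sumr_ge0.
Qed.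

(** The operators [x |-> sum_k <x, e k> h k]. For Bessel sequences [e] and [h] such an
    operator is bounded, and exchanging [e] and [h] gives its adjoint. Up to scalar
    operators, all operators constructed below have this form. *)
Definition series_op e h (A : H -> H) :=
  forall x, series (fun k => ip x (e k) *: h k) @ \oo --> A x.

Lemma bessel_cvg M M' e h x : bessel M e -> bessel M' h ->
  cvgn (series (fun k => ip x (e k) *: h k)).
Proof.
move=> eM [M'0 hM].
apply/cauchy_cvgP/cauchy_seriesP => eps eps0.
have e0' : 0 < complex.Re eps by move: eps0; rewrite ltcE /= => /andP[].
have eE : eps = (complex.Re eps)%:C by rewrite RRe_real// gtr0_real.
have d0 : 0 < complex.Re eps ^+ 2 / (M' + 1) by rewrite divr_gt0 ?exprn_gt0// ltr_wpDl.
have cb n := bessel_coef x 0 n eM.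
have := square_summable_cauchy (fun k => sqr_ge0 _) cb d0.
apply: filterS => -[n m] /=; rewrite ltr_pdivlMr ?ltr_wpDl// => h1.
rewrite rnormE eE ltcR -(@ltr_pXn2r _ 2)// ?nnegrE ?rnorm_ge0 ?ltW//.
apply: le_lt_trans h1; apply: (le_trans (hM _ _ _)).
rewrite mulrC ler_wpM2l ?lerDl// sumr_ge0// => k _; exact: sqr_ge0.
Qed.

Lemma series_op_bound M M' e h A : bessel M e -> bessel M' h -> series_op e h A ->
  forall x, rnorm (A x) ^+ 2 <= M * M' * rnorm x ^+ 2.
Proof.
move=> eM [M'0 hM] eA x.
have Ax := cvg_rnorm (eA x).
have Ax2 : rnorm (series (fun k => ip x (e k) *: h k) n) ^+ 2 @[n --> \oo] --> rnorm (A x) ^+ 2.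
  rewrite expr2; under eq_fun do rewrite expr2; exact: cvgM.
rewrite -(cvg_lim _ Ax2)//; apply: limr_le; first by apply/cvg_ex; exists (rnorm (A x) ^+ 2).
apply: nearW => n; apply: (le_trans (hM _ _ _)).
rewrite [M * M']mulrC -mulrA ler_wpM2l//; exact: bessel_coef.
Qed.

Lemma series_op_bounded M M' e h (A : {linear H -> H}) :
  bessel M e -> bessel M' h -> series_op e h A -> bounded_op A.
Proof.
move=> eM hM eA; apply: (@bounded_op_of _ _ _ (Num.sqrt (M * M'))) => x.
have MM : 0 <= M * M' by rewrite mulr_ge0 ?eM.1 ?hM.1.
rewrite -(@ler_pXn2r _ 2)// ?nnegrE ?mulr_ge0 ?rnorm_ge0 ?sqrtr_ge0// exprMn sqr_sqrtr//.
exact: series_op_bound eM hM eA x.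
Qed.

Lemma series_op_linear e h (A : H -> H) : series_op e h A -> linear A.
Proof.
move=> eA a x y; apply: (cvg_uniqueH (eA _)).
have -> : series (fun k => ip (a *: x + y) (e k) *: h k) =
  (fun n => a *: series (fun k => ip x (e k) *: h k) n + series (fun k => ip y (e k) *: h k) n).
  apply/funext => n; rewrite /series/= scaler_sumr -big_split/=.
  by apply: eq_bigr => k _; rewrite ipDl ipZl scalerDl scalerA.
apply: cvgD; [apply: cvgZr|]; exact: eA.
Qed.

Lemma series_op_exists M M' e h : bessel M e -> bessel M' h ->
  exists A : {linear H -> H}, series_op e h A.
Proof.
move=> eM hM; pose A x := limn (series (fun k => ip x (e k) *: h k)).
have eA : series_op e h A by move=> x; exact: bessel_cvg eM hM.
pose Amix := GRing.isLinear.Build _ _ _ _ A (series_op_linear eA).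
pose AL : {linear H -> H} := HB.pack_for {linear H -> H} A Amix.
by exists AL.
Qed.

Lemma series_op_adjoint e h (A B : {linear H -> H}) :
  series_op e h A -> series_op h e B -> is_adjoint ip A B.
Proof.
move=> eA hB x y; apply: (cvg_ip_eq ip_norm (eA x) (hB y)) => n.
rewrite /series/= ip_suml ip_sumr; apply: eq_bigr => k _.
by rewrite ipZl ipZr mulrC -ipC.
Qed.

Lemma series_op_comp e h (A B : {linear H -> H}) :
  bounded_op B -> series_op e h A -> series_op e (B \o h) (B \o A).
Proof.
move=> Bb eA x.
have -> : series (fun k => ip x (e k) *: (B \o h) k) =
   B \o series (fun k => ip x (e k) *: h k).
  by apply/funext => n; rewrite /series/= linear_sum; apply: eq_bigr => k _; rewrite linearZ.
exact: (cvg_bounded_op Bb (eA x)).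
Qed.

Lemma series_op_unique e h (A B : H -> H) :
  series_op e h A -> series_op e h B -> A =1 B.
Proof. by move=> eA eB x; apply: cvg_uniqueH (eA x) (eB x). Qed.

End Bessel.

(** * Diagonal operators *)

Section Diagonal.
Context {R : realType} {H : completeNormedModType R[i]}.
Variable ip : {dot H for @Num.conj R[i]}.
Hypothesis ip_norm : inner_product_norm ip.
Implicit Types (h e : nat -> H) (M : R) (a b : nat -> R).

(** Zero vectors are allowed, so that an operator of finite rank also has an
    eigensystem indexed by all of [nat]. *)
Definition orthosystem e :=
  (forall n m, n <> m -> ip (e n) (e m) = 0) /\
  (forall n, ip (e n) (e n) = 1 \/ e n = 0).

Definition diag_op e a (A : H -> H) := series_op ip e (fun k => (a k)%:C *: e k) A.

Lemma pythagoras (u : nat -> H) n m :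
  (forall i j, i <> j -> ip (u i) (u j) = 0) ->
  rnorm (\sum_(n <= k < m) u k) ^+ 2 = \sum_(n <= k < m) rnorm (u k) ^+ 2.
Proof.
move=> uo; elim: m => [|m IH]; first by rewrite !big_geq// rnorm0 expr0n.
have [mn|nm] := ltnP m n; first by rewrite !big_geq// rnorm0 expr0n.
rewrite !big_nat_recr//= (rnormD_sqr ip_norm) IH ip_suml [X in complex.Re X]big1_seq ?mulr0 ?addr0// => k.
by rewrite mem_index_iota => /andP[_ /andP[_ km]]; rewrite uo//; move/ltn_eqF/eqP: km.
Qed.

Lemma orthosystem_rnorm e n : orthosystem e -> rnorm (e n) <= 1.
Proof.
move=> [_ /(_ n)[|->]]; last by rewrite rnorm0.
rewrite (ip_rnorm ip_norm) => -[] h; rewrite -(@ler_pXn2r _ 2)// ?nnegrE ?rnorm_ge0//.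
by rewrite h expr1n.
Qed.

Lemma diag_bessel e a C : orthosystem e -> (forall k, `|a k| <= C) ->
  bessel (C ^+ 2) (fun k => (a k)%:C *: e k).
Proof.
move=> eo aC; split; first exact: sqr_ge0.
move=> c n m; rewrite pythagoras; last first.
  by move=> i j ij; rewrite !ipZl !ipZr eo.1// !mulr0.
rewrite mulr_sumr; apply: ler_sum => k _.
have C0 : 0 <= C by apply: le_trans (aC k).
rewrite !rnormZ !exprMn mulrC ler_wpM2r ?sqr_ge0// rnormR.
rewrite -exprMn ler_sqr ?nnegrE ?mulr_ge0 ?rnorm_ge0//.
by rewrite -[leRHS]mulr1 ler_pM ?rnorm_ge0// (orthosystem_rnorm k eo).
Qed.

Lemma orthosystem_bessel e : orthosystem e -> bessel 1 e.
Proof.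
move=> eo; have := @diag_bessel e (fun=> 1) 1 eo; rewrite expr1n.
have -> : (fun k => 1%:C *: e k) = e by apply/funext => k; rewrite scale1r.
by apply => k; rewrite normr1.
Qed.

Lemma diag_op_exists e a C : orthosystem e -> (forall k, `|a k| <= C) ->
  exists2 A : {linear H -> H}, diag_op e a A & bounded_op A.
Proof.
move=> eo aC.
have [A eA] := series_op_exists ip_norm (orthosystem_bessel eo) (diag_bessel eo aC).
by exists A => //; apply: (series_op_bounded ip_norm (orthosystem_bessel eo) (diag_bessel eo aC)).
Qed.

Lemma diag_op_bounded e a C (A : {linear H -> H}) : orthosystem e ->
  (forall k, `|a k| <= C) -> diag_op e a A -> bounded_op A.
Proof.
move=> eo aC; exact: (series_op_bounded ip_norm (orthosystem_bessel eo) (diag_bessel eo aC)).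
Qed.

Lemma diag_op_adjoint e a (A : {linear H -> H}) : diag_op e a A -> is_adjoint ip A A.
Proof.
move=> eA x y; apply: (cvg_ip_eq ip_norm (eA x) (eA y)) => n.
rewrite /series/= ip_suml ip_sumr; apply: eq_bigr => k _.
by rewrite !ipZl !ipZr cjR -ipC; ring.
Qed.

Lemma diag_op_eigen e a (A : {linear H -> H}) n : orthosystem e ->
  diag_op e a A -> A (e n) = (a n)%:C *: e n.
Proof.
move=> eo eA; apply: (cvg_uniqueH (eA _)); apply: cvg_near_cst.
near=> m; rewrite /series/= (big_rem n)/= ?mem_index_iota//=; last first.
  by near: m; exists n.+1.
rewrite big1_seq ?addr0; last first.
  move=> k; rewrite (rem_filter _ (iota_uniq _ _)) mem_filter /= => /andP[/eqP kn _].
  by rewrite eo.1 ?scale0r// => nk; apply: kn.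
by case: (eo.2 n) => ->; rewrite ?scale1r// ip0l scale0r scaler0.
Unshelve. all: by end_near. Qed.

Lemma diag_op_coef e a (A : {linear H -> H}) n x : orthosystem e ->
  diag_op e a A -> ip (A x) (e n) = (a n)%:C * ip x (e n).
Proof.
by move=> eo eA; rewrite (diag_op_adjoint eA) (diag_op_eigen _ eo eA) ipZr cjR.
Qed.

Lemma diag_op_comp e a b (A B : {linear H -> H}) : orthosystem e ->
  diag_op e a A -> diag_op e b B -> diag_op e (fun k => a k * b k) (A \o B).
Proof.
move=> eo eA eB x.
have -> : series (fun k => ip x (e k) *: ((a k * b k)%:C *: e k)) =
  series (fun k => ip (B x) (e k) *: ((a k)%:C *: e k)).
  apply/funext => n; rewrite /series/=; apply: eq_bigr => k _.
  by rewrite (diag_op_coef _ _ eo eB) !scalerA rcM; congr (_ *: _); ring.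
exact: eA.
Qed.

Lemma diag_op_quadratic e a (A : {linear H -> H}) x : diag_op e a A ->
  ip (A x) x = (complex.Re (ip (A x) x))%:C /\
  series (fun k => a k * rnorm (ip x (e k)) ^+ 2) @ \oo --> complex.Re (ip (A x) x).
Proof.
move=> eA; split.
  have : ip (A x) x = cj (ip (A x) x) by rewrite -ipC -(diag_op_adjoint eA).
  by case: (ip _ _) => u v /= [] /eqP; rewrite -subr_eq0 opprK -mulr2n mulrn_eq0/= => /eqP ->.
have := cvg_Re_ip (y := x) ip_norm (eA x).
suff -> : (fun n => complex.Re (ip (series (fun k => ip x (e k) *: ((a k)%:C *: e k)) n) x)) =
  series (fun k => a k * rnorm (ip x (e k)) ^+ 2) by [].
apply/funext => n; rewrite /series/= ip_suml raddf_sum; apply: eq_bigr => k _ /=.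
rewrite !ipZl (ipC _ (e k) x).
suff -> : ip x (e k) * ((a k)%:C * cj (ip x (e k))) = (a k * rnorm (ip x (e k)) ^+ 2)%:C by [].
by rewrite rcM rnorm_sqrE; ring.
Qed.

Lemma diag_op_pos e a (A : {linear H -> H}) : (forall k, 0 <= a k) ->
  diag_op e a A -> positive_op ip A.
Proof.
move=> a0 eA x; have [-> cA] := diag_op_quadratic x eA.
rewrite lecR -(cvg_lim _ cA)//; apply: limr_ge; first by apply/cvg_ex; eexists; exact: cA.
by apply: nearW => n; apply: sumr_ge0 => k _; rewrite mulr_ge0 ?sqr_ge0.
Qed.

Lemma diag_op_modulus e a C (A T B S : {linear H -> H}) : orthosystem e ->
  (forall k, 0 <= a k <= C) -> diag_op e a T ->
  is_adjoint ip A B -> diag_op e (fun k => a k ^+ 2) S -> (forall x, B (A x) = S x) ->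
  is_modulus ip A T.
Proof.
move=> eo aC eT AB eS BA; split.
- by apply: (diag_op_bounded (C := C) eo _ eT) => k; rewrite ger0_norm; case/andP: (aC k).
- by apply: diag_op_pos eT => k; case/andP: (aC k).
- exists B => // x; rewrite BA; apply: (series_op_unique (diag_op_comp eo eT eT) _).
  by under [X in series_op ip e X]eq_fun do rewrite -expr2.
Qed.

Lemma diag_op_modulus_self e a C (A : {linear H -> H}) : orthosystem e ->
  (forall k, 0 <= a k <= C) -> diag_op e a A -> is_modulus ip A A.
Proof.
move=> eo aC eA; split.
- by apply: (diag_op_bounded (C := C) eo _ eA) => k; rewrite ger0_norm; case/andP: (aC k).
- by apply: diag_op_pos eA => k; case/andP: (aC k).
- by exists A => //; exact: diag_op_adjoint eA.
Qed.

End Diagonal.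

(** * Compact positive operators *)

Section Positive.
Context {R : realType} {H : completeNormedModType R[i]}.
Variable ip : {dot H for @Num.conj R[i]}.
Hypothesis ip_norm : inner_product_norm ip.

(** Polarization: a form that is real on the diagonal is Hermitian. *)
Lemma positive_op_selfadjoint (A : {linear H -> H}) : positive_op ip A -> is_adjoint ip A A.
Proof.
move=> Apos.
have d x : ip (A x) x = ip x (A x).
  by rewrite [RHS]ipC -(RRe_real (ger0_real (Apos x))) cjR.
have s x y : ip (A x) y + ip (A y) x = ip x (A y) + ip y (A x).
  have := d (x + y); rewrite linearD !ipDl !ipDr !d => h.
  have -> : ip (A x) y + ip (A y) x =
    (ip x (A x) + ip (A x) y + (ip (A y) x + ip y (A y))) - ip x (A x) - ip y (A y) by ring.
  by rewrite h; ring.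
move=> x y; have h1 := s x y; have := s ('i%C *: x) y.
rewrite linearZ !ipZl !ipZr => h2.
have i2 : ('i%C : R[i]) * 'i%C = -1 by rewrite -expr2 sqr_i.
have ci : cj ('i%C : R[i]) = - 'i%C.
  by rewrite -[LHS]/(conjc _)/= /conjc; apply/eqP; rewrite eq_complex/= oppr0 !eqxx.
have h3 : ip (A x) y - ip (A y) x = ip x (A y) - ip y (A x).
  apply: (@mulfI _ ('i%C : R[i])); first by rewrite eq_complex/= oner_eq0 andbF.
  move: h2; rewrite ci => h2.
  by rewrite !mulrBr -[in LHS]mulNr h2 mulNr.
have : 2%:R * ip (A x) y = 2%:R * ip x (A y).
  have -> : 2%:R * ip (A x) y = (ip (A x) y + ip (A y) x) + (ip (A x) y - ip (A y) x) by ring.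
  by rewrite h1 h3; ring.
by apply: mulfI; rewrite pnatr_eq0.
Qed.

Variables (S : {linear H -> H}).
Hypotheses (S_pos : positive_op ip S) (S_bounded : bounded_op S).

Let q x : R := complex.Re (ip (S x) x).

Lemma positive_opE x : ip (S x) x = (q x)%:C.
Proof. by rewrite RRe_real// ger0_real. Qed.

Lemma quadratic_ge0 x : 0 <= q x.
Proof. by rewrite -ler0c -positive_opE. Qed.

Definition orthogonal_to (W : set H) : set H := [set x | forall e, W e -> ip x e = 0].

Definition eigenvectors (W : set H) := forall e, W e -> exists l : R, S e = l%:C *: e.

Lemma orthogonal_to_stable W x : eigenvectors W -> orthogonal_to W x -> orthogonal_to W (S x).
Proof.
move=> WS Wx e We; rewrite positive_op_selfadjoint//.
by have [l ->] := WS e We; rewrite ipZr Wx// mulr0.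
Qed.

Lemma orthogonal_to_comb W (a : R[i]) x y :
  orthogonal_to W x -> orthogonal_to W y -> orthogonal_to W (a *: x + y).
Proof. by move=> Wx Wy e We; rewrite ipDl ipZl Wx// Wy// mulr0 addr0. Qed.

(** With [0 <= S <= l] one has [l S (l - S) = (l - S) S (l - S) + S (l - S) S >= 0],
    that is, [S^2 <= l S]. *)
Lemma sqr_le_quadratic W l x : eigenvectors W -> 0 < l ->
  (forall x, orthogonal_to W x -> q x <= l * rnorm x ^+ 2) ->
  orthogonal_to W x -> rnorm (S x) ^+ 2 <= l * q x.
Proof.
move=> WS l0 Sl Wx.
pose u := (- l%:C) *: x + S x.
have Wu := orthogonal_to_comb (- l%:C) Wx (orthogonal_to_stable WS Wx).
have hS := Sl _ (orthogonal_to_stable WS Wx).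
have hu := quadratic_ge0 u.
suff : l * (l * q x - rnorm (S x) ^+ 2) = q u + (l * rnorm (S x) ^+ 2 - q (S x)).
  move=> h; have : 0 <= l * (l * q x - rnorm (S x) ^+ 2) by rewrite h; lra.
  by rewrite pmulr_rge0// subr_ge0.
have := ip_rnorm ip_norm (S x); move: (rnorm (S x) ^+ 2) => r rE.
apply: complexI; rewrite rcM rcB rcM rcD rcB rcM -!positive_opE -rE.
have -> : S u = - l%:C *: S x + S (S x) by rewrite linearD linearZ.
rewrite /u !ipDl !ipDr !ipZl !ipZr cjN cjR.
rewrite [ip (S (S x)) x](positive_op_selfadjoint S_pos); ring.
Qed.

Hypothesis S_compact : compact_op S.

(** The images under [S] of the vectors of the unit ball in [Q e], for [e] tending to
    [0], form a filter base in a compact set; its cluster point replaces the limit of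
    a convergent subsequence. *)
Lemma compact_op_cluster (Q : R -> set H) :
  (forall d e, d <= e -> Q d `<=` Q e) ->
  (forall e, 0 < e -> exists x, rnorm x <= 1 /\ Q e x) ->
  exists y, forall e, 0 < e -> exists x, [/\ rnorm x <= 1, Q e x & rnorm (S x - y) < e].
Proof.
move=> Qmono Qex; have [U US [Uc _]] := S_compact.
pose B e := S @` [set x | rnorm x <= 1 /\ Q e x].
pose F := filter_from [set e : R | 0 < e] B.
have FF : ProperFilter F.
  apply: filter_from_proper.
    apply: filter_from_filter; first by exists 1; exact: ltr01.
    move=> i j /= i0 j0; exists (Num.min i j); first by rewrite /= lt_min i0.
    move=> _ [x [x1 Qx] <-]; split; exists x => //; split => //; apply: Qmono Qx.
      by rewrite ge_min lexx.
    by rewrite ge_min lexx orbT.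
  by move=> e /Qex [x Qx]; exists (S x), x.
have FU : F U.
  exists 1; first exact: ltr01.
  move=> _ [x [x1 _] <-]; apply: US; exists x => //=.
  by rewrite rnormE (_ : 1 = 1%:C)// lecR.
have [y [_ yF]] := Uc F FF FU.
exists y => e e0.
have Fe : F (B e) by exists e.
have ny : nbhs y [set z | rnorm (z - y) < e].
  apply/nbhs_ballP; exists e%:C; first by rewrite /= (_ : 0 = 0%:C)// ltcR.
  by move=> z; rewrite -ball_normE/= rnormE ltcR rdistC.
have [_ [[x [x1 Qx] <-] xy]] := yF _ _ Fe ny.
by exists x.
Qed.

(** Let [l] be the supremum of [<S x, x>] over the unit ball orthogonal to [W]. As
    [S^2 <= l S] there, near-maximizers satisfy
    [|S x - l x|^2 <= l^2 - l <S x, x>], which is small; a cluster point [y] of the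
    [S x] is therefore an eigenvector, and [|y| >= l]. If [l = 0] the zero vector is
    taken. *)
Lemma next_eigenvector W : eigenvectors W ->
  exists p : H * R, [/\ 0 <= p.2, S p.1 = p.2%:C *: p.1, orthogonal_to W p.1,
    (0 < p.2 -> ip p.1 p.1 = 1) /\ (p.2 = 0 -> p.1 = 0)
    & forall x, orthogonal_to W x -> q x <= p.2 * rnorm x ^+ 2].
Proof.
move=> WS; have [M M0 SM] := bounded_opP S_bounded.
pose X := [set q x | x in [set x | orthogonal_to W x /\ rnorm x <= 1]].
have W0 : orthogonal_to W 0 by move=> e _; rewrite ip0l.
have X0 : X 0 by exists 0; rewrite /q ?ip0r//= rnorm0.
have qle x : q x <= rnorm (S x) * rnorm x.
  exact: le_trans (ler_Re_rnorm _) (cauchy_schwarz ip_norm _ _).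
have Xub : has_sup X.
  split; first by exists 0.
  exists M => _ [x [_ x1] <-]; apply: (le_trans (qle x)).
  have := SM x; have := rnorm_ge0 x; have := rnorm_ge0 (S x); nra.
pose l := sup X.
have l0 : 0 <= l by apply: sup_upper_bound.
have lq x : orthogonal_to W x -> q x <= l * rnorm x ^+ 2.
  move=> Wx; have [->|x0] := eqVneq x 0.
    by rewrite /q ip0r rnorm0 expr0n mulr0.
  have n0 : 0 < rnorm x.
    by rewrite lt_neqAle rnorm_ge0 andbT eq_sym; apply: contra_neq x0; exact: rnorm_eq0.
  have : X (q ((rnorm x)^-1%:C *: x)).
    exists ((rnorm x)^-1%:C *: x) => //; split.
      by move=> e We; rewrite ipZl Wx// mulr0.
    by rewrite rnormZ rnormR ger0_norm ?invr_ge0 ?rnorm_ge0// mulVf// gt_eqF.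
  move=> /(sup_upper_bound Xub); rewrite -/l.
  have -> : q ((rnorm x)^-1%:C *: x) = q x / rnorm x ^+ 2.
    apply: complexI; rewrite -positive_opE [S _]linearZ ipZl ipZr cjR positive_opE.
    by rewrite -!rcM; congr _%:C; rewrite -exprVn; ring.
  by rewrite ler_pdivrMr ?exprn_gt0.
have [le0|lgt0] := leP l 0.
  have l00 : l = 0 by apply/le_anti; rewrite le0.
  by exists (0, 0); split; rewrite //= ?linear0 ?scaler0// ?ltxx//; move=> x /lq; rewrite l00.
pose Q e := [set x | [/\ orthogonal_to W x, rnorm (S x - l%:C *: x) <= e & l - e <= rnorm (S x)]].
have Qmono d e : d <= e -> Q d `<=` Q e.
  by move=> de x [? ? ?]; split => //; lra.
have [e e0|y yQ] := compact_op_cluster Qmono.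
  (* [<S x, x> > l - d] makes [|S x - l x|^2] at most [l * d <= e ^+ 2]. *)
  pose d := Num.min e (e ^+ 2 / l).
  have d0 : 0 < d by rewrite lt_min e0 divr_gt0// exprn_gt0.
  have [_ [x [Wx x1] <-]] := sup_adherent d0 Xub; rewrite -/l => xd.
  have de : d <= e by rewrite ge_min lexx.
  have del : d * l <= e ^+ 2 by rewrite -ler_pdivlMr// ge_min lexx orbT.
  exists x; split => //; split => //; last first.
    have := qle x; have := rnorm_ge0 x; have := rnorm_ge0 (S x); nra.
  rewrite -(@ler_pXn2r _ 2)// ?nnegrE ?rnorm_ge0 ?ltW//.
  have -> : rnorm (S x - l%:C *: x) ^+ 2 = rnorm (S x) ^+ 2 + l ^+ 2 * rnorm x ^+ 2 - 2 * l * q x.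
    rewrite (rnormD_sqr ip_norm) rnormN rnormZ rnormR exprMn ger0_norm//.
    rewrite ipNr ipZr cjR positive_opE -rcM -rcN /=; ring.
  have := sqr_le_quadratic WS lgt0 lq Wx.
  have : rnorm x ^+ 2 <= 1 by rewrite expr_le1 ?rnorm_ge0.
  have : 0 <= l ^+ 2 by exact: sqr_ge0.
  nra.
have yl : l <= rnorm y.
  apply/ler_addgt0Pl => e e0; have e20 : 0 < e / 2 by lra.
  have [x [x1 [_ _ lx] xy]] := yQ _ e20.
  by have := ler_rnormD (S x - y) y; rewrite subrK; lra.
have ylx e : 0 < e -> exists x, [/\ orthogonal_to W x, rnorm (S x - y) <= e & rnorm (y - l%:C *: x) <= e].
  move=> e0; have e20 : 0 < e / 2 by lra.
  have [x [x1 [Wx Sl _] xy]] := yQ _ e20; exists x; split => //; first lra.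
  have := ler_rnormD (y - S x) (S x - l%:C *: x); rewrite addrA subrK (rdistC y (S x)); lra.
have Sy : S y = l%:C *: y.
  apply/subr0_eq/rnorm_small => e e0.
  have d0 : 0 < e / (M + l + 1) by rewrite divr_gt0//; lra.
  have [x [Wx xy yx]] := ylx _ d0.
  have -> : S y - l%:C *: y = S (y - l%:C *: x) + l%:C *: (S x - y).
    by rewrite [S (_ - _)]linearB [S (_ *: _)]linearZ/= scalerBr addrA subrK.
  apply: (le_trans (ler_rnormD _ _)); rewrite rnormZ rnormR ger0_norm//.
  set d := e / _ in d0 xy yx; have de : d * (M + l + 1) = e by rewrite mulfVK// gt_eqF//; lra.
  have := SM (y - l%:C *: x); nra.
have Wy : orthogonal_to W y.
  move=> e We; apply: rnorm_small => eps eps0.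
  have d0 : 0 < eps / (rnorm e + 1) by rewrite divr_gt0// ltr_wpDl ?rnorm_ge0.
  have [x [Wx _ yx]] := ylx _ d0.
  have -> : ip y e = ip (y - l%:C *: x) e by rewrite ipBl ipZl Wx// mulr0 subr0.
  apply: (le_trans (cauchy_schwarz ip_norm _ _)).
  set d := eps / _ in d0 yx; have de : d * (rnorm e + 1) = eps.
    by rewrite mulfVK// gt_eqF// ltr_wpDl ?rnorm_ge0.
  have := rnorm_ge0 e; nra.
have y0 : 0 < rnorm y by lra.
exists ((rnorm y)^-1%:C *: y, l); split => //=.
- by rewrite linearZ/= Sy !scalerA mulrC.
- by move=> e We; rewrite ipZl Wy// mulr0.
- split; last by move=> l00; move: lgt0; rewrite l00 ltxx.
  move=> _; rewrite ipZl ipZr cjR (ip_rnorm ip_norm) -!rcM.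
  by rewrite expr2 mulKf ?gt_eqF// mulVf ?gt_eqF.
Qed.

End Positive.

Section Spectral.
Context {R : realType} {H : completeNormedModType R[i]}.
Variable ip : {dot H for @Num.conj R[i]}.
Hypothesis ip_norm : inner_product_norm ip.

(** Eigenvectors are chosen one after the other by [next_eigenvector], each
    orthogonal to the previous ones. The eigenvalues tend to [0], because vectors
    [S (e n)] with [a n >= d] have mutual distance at least [d]. Removing the first
    [n] components from [x] leaves a vector on which [S] has norm at most [a n]. *)
Theorem compact_positive_diagonal (S : {linear H -> H}) :
  positive_op ip S -> bounded_op S -> compact_op S ->
  exists e (a : nat -> R), [/\ orthosystem ip e,
    forall k, 0 <= a k /\ (0 < a k -> ip (e k) (e k) = 1),
    nonincreasing_seq a, a @ \oo --> 0 & diag_op ip e a S].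
Proof.
move=> S_pos S_bounded S_compact.
pose good W (p : H * R) := [/\ 0 <= p.2, S p.1 = p.2%:C *: p.1, orthogonal_to ip W p.1,
    (0 < p.2 -> ip p.1 p.1 = 1) /\ (p.2 = 0 -> p.1 = 0)
    & forall x, orthogonal_to ip W x -> complex.Re (ip (S x) x) <= p.2 * rnorm x ^+ 2].
pose pick W := xget (0, 0) (good W).
pose prev := fix prev n := if n is m.+1 then prev m `|` [set (pick (prev m)).1] else set0.
pose e n := (pick (prev n)).1; pose a n := (pick (prev n)).2.
have prevS n : prev n.+1 = prev n `|` [set e n] by [].
have prevE n x : prev n x -> exists2 k, (k < n)%N & x = e k.
  elim: n => [[]|n IH]; rewrite prevS => -[/IH[k kn ->]|->]; last by exists n.
  by exists k => //; apply: leq_trans kn _.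
have prev_e k n : (k < n)%N -> prev n (e k).
  elim: n => // n IH; rewrite prevS ltnS leq_eqVlt => /predU1P[->|/IH]; by [right|left].
have step m : eigenvectors S (prev m) -> good (prev m) (e m, a m).
  move=> /(next_eigenvector ip_norm S_pos S_bounded S_compact)[p gp].
  by rewrite /e /a -surjective_pairing; exact: xgetI gp.
have eig n : eigenvectors S (prev n).
  elim: n => [x []|n IH]; rewrite prevS => x [/IH//|->].
  by exists (a n); have [] := step _ IH.
have good_n n : good (prev n) (e n, a n) by exact: step.
have a0 n : 0 <= a n by have [] := good_n n.
have Se n : S (e n) = (a n)%:C *: e n by have [] := good_n n.
have e1 n : 0 < a n -> ip (e n) (e n) = 1 by have [_ _ _ []] := good_n n.
have olt n m : (m < n)%N -> ip (e n) (e m) = 0.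
  by move=> mn; have [_ _ + _ _] := good_n n; apply; exact: prev_e.
have eo : orthosystem ip e.
  split=> [n m nm|n].
    have [mn|nm'|/esym//] := ltngtP m n; first exact: olt.
    by rewrite ipC olt// -[RHS](cjR 0).
  have [an|an] := eqVneq (a n) 0; last by left; apply: e1; rewrite lt_neqAle eq_sym an a0.
  by right; have [_ _ _ [_ /(_ an)]] := good_n n.
have a_bound n x : orthogonal_to ip (prev n) x -> complex.Re (ip (S x) x) <= a n * rnorm x ^+ 2.
  by have [_ _ _ _] := good_n n; exact.
have a_decr : nonincreasing_seq a.
  apply/nonincreasing_seqP => n.
  have [->|an] := eqVneq (a n.+1) 0; first exact: a0.
  have en : ip (e n.+1) (e n.+1) = 1 by apply: e1; rewrite lt_neqAle eq_sym an a0.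
  have := @a_bound n (e n.+1); rewrite Se ipZl en mulr1/=.
  have : (rnorm (e n.+1) ^+ 2)%:C = 1%:C by rewrite -(ip_rnorm ip_norm) en.
  move=> /complexI ->; rewrite mulr1; apply.
  by move=> x /prevE[k kn ->]; apply: olt; apply: leq_trans kn _.
have a_small d : 0 < d -> exists n, a n < d.
  move=> d0; apply: contrapT => /forallNP h.
  have da n : d <= a n by rewrite leNgt; apply/negP/h.
  pose Q (_ : R) : set H := [set x | exists2 n, x = e n & True].
  have [U US [Uc _]] := S_compact.
  have FU : (S \o e @ \oo) U.
    exists 0%N => // n _; apply: US; exists (e n) => //=.
    by rewrite rnormE (_ : 1 = 1%:C)// lecR (orthosystem_rnorm ip_norm).
  have [y [_ yF]] := Uc _ _ FU.
  have ny : nbhs y [set z | rnorm (z - y) < d / 2].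
    apply/nbhs_ballP; exists (d / 2)%:C; first by rewrite /= (_ : 0 = 0%:C)// ltcR divr_gt0.
    by move=> z; rewrite -ball_normE/= rnormE ltcR rdistC.
  have ex N : exists2 n, (N <= n)%N & rnorm (S (e n) - y) < d / 2.
    have FN : (S \o e @ \oo) [set z | exists2 n, (N <= n)%N & z = S (e n)].
      by exists N => // n /= Nn; exists n.
    by have [_ [[n Nn ->] ?]] := yF _ _ FN ny; exists n.
  have [n _ yn] := ex 0%N; have [m nm ym] := ex n.+1.
  have dist : rnorm (S (e m) - S (e n)) < d.
    have := ler_rnormB (S (e m) - y) (S (e n) - y).
    have -> : S (e m) - y - (S (e n) - y) = S (e m) - S (e n) by rewrite opprB addrA subrK.
    lra.
  have : d ^+ 2 <= rnorm (S (e m) - S (e n)) ^+ 2.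
    have apos k : 0 < a k by apply: lt_le_trans d0 (da k).
    have en k : rnorm (e k) ^+ 2 = 1.
      by apply: complexI; rewrite -(ip_rnorm ip_norm) e1.
    rewrite (rnormD_sqr ip_norm) rnormN !Se !rnormZ !exprMn !en !mulr1 !rnormR.
    rewrite ipNr !ipZl !ipZr olt// !mulr0 oppr0/= mulr0 addr0 !ger0_norm//.
    have := da m; have := da n; nra.
  by rewrite leNgt ltr_pXn2r ?nnegrE ?rnorm_ge0 ?(ltW d0)// dist.
have a_cvg : a @ \oo --> 0.
  apply/cvgrPdist_lt => d d0; have [N aN] := a_small d d0.
  by exists N => // n /= Nn; rewrite sub0r normrN ger0_norm//; apply: le_lt_trans aN; apply: a_decr.
exists e, a; split=> //; first by move=> k; split; [exact: a0|exact: e1].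
move=> x; apply/cvg_rnormP => eps eps0.
have d0 : 0 < eps / (2 * (rnorm x + 1)) by rewrite divr_gt0// mulr_gt0// ltr_wpDl ?rnorm_ge0.
set d := eps / _ in d0; have [N aN] := a_small d d0.
exists N => // n /= Nn.
pose xn := x - \sum_(0 <= k < n) ip x (e k) *: e k.
have xn_coef k : (k < n)%N -> ip xn (e k) = 0.
  move=> kn; rewrite /xn ipBl ip_suml (big_rem k)/= ?mem_index_iota//=.
  rewrite big1_seq ?addr0; last first.
    move=> j; rewrite (rem_filter _ (iota_uniq _ _)) mem_filter /= => /andP[/eqP jk _].
    by rewrite ipZl eo.1 ?mulr0.
  by rewrite ipZl; case: (eo.2 k) => ->; rewrite ?mulr1 ?subrr// !ip0r mul0r subr0.
have -> : S x - series (fun k => ip x (e k) *: ((a k)%:C *: e k)) n = S xn.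
  rewrite /xn [RHS]raddfB/= [S (\sum_(_ <= _ < _) _)]raddf_sum; congr (_ - _); rewrite /series/=.
  by apply: eq_bigr => k _; rewrite [S _]linearZ/= Se.
have Wxn : orthogonal_to ip (prev n) xn.
  by move=> z /prevE[k kn ->]; exact: xn_coef.
have and_ : a n <= d by apply: ltW; apply: le_lt_trans aN; apply: a_decr.
have bd z : orthogonal_to ip (prev n) z -> complex.Re (ip (S z) z) <= d * rnorm z ^+ 2.
  by move=> /a_bound h; apply: (le_trans h); rewrite ler_wpM2r// sqr_ge0.
have h1 := sqr_le_quadratic ip_norm S_pos (eig n) d0 bd Wxn.
have h2 := bd _ Wxn.
have xnx : rnorm xn ^+ 2 <= rnorm x ^+ 2.
  have -> : x = xn + \sum_(0 <= k < n) ip x (e k) *: e k by rewrite subrK.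
  rewrite [leRHS](rnormD_sqr ip_norm) ip_sumr [\sum_(_ <= _ < _) ip _ _]big1_seq ?mulr0 ?addr0.
    by rewrite lerDl sqr_ge0.
  by move=> k; rewrite mem_index_iota => /andP[_ /andP[_ kn]]; rewrite ipZr xn_coef ?mulr0.
have h3 : rnorm (S xn) <= d * rnorm x.
  have dx0 : 0 <= d * rnorm x by rewrite mulr_ge0 ?rnorm_ge0 ?(ltW d0).
  rewrite -(@ler_pXn2r _ 2)// ?nnegrE ?rnorm_ge0// [leRHS]exprMn.
  apply: (le_trans h1); apply: (@le_trans _ _ (d * (d * rnorm xn ^+ 2))).
    by rewrite ler_wpM2l// ltW.
  by rewrite mulrA -expr2 ler_wpM2l ?sqr_ge0.
apply: (le_lt_trans h3).
have de : d * (2 * (rnorm x + 1)) = eps.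
  by rewrite mulfVK// gt_eqF// mulr_gt0// ltr_wpDl ?rnorm_ge0.
have := rnorm_ge0 x; nra.
Qed.

End Spectral.

Section Compactness.
Context {R : realType} {H : completeNormedModType R[i]}.
Variable ip : {dot H for @Num.conj R[i]}.
Hypothesis ip_norm : inner_product_norm ip.

(** In a complete space it suffices that for every [eps] the set stays within [eps]
    of some compact set: an ultrafilter on it is then Cauchy. *)
Lemma precompact_approx (C : set H) :
  (forall eps : R, 0 < eps -> exists2 K, compact K &
     forall y, C y -> exists2 z, K z & rnorm (y - z) <= eps) -> precompact C.
Proof.
move=> CK; rewrite precompactE compact_ultra => F UF FC.
have PF : ProperFilter F by exact: ultra_proper.
have : cvg F.
  apply/cauchy_cvgP/cauchy_exP => eps eps0.
  have e0 : 0 < complex.Re eps by move: eps0; rewrite ltcE /= => /andP[].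
  have eE : eps = (complex.Re eps)%:C by rewrite RRe_real// gtr0_real.
  set e := complex.Re eps in e0 eE.
  have e40 : 0 < e / 4 by lra.
  have [K Kc CKe] := CK _ e40.
  (* The ultrafilter is pushed to [K] along an almost-nearest-point map [s]. *)
  have near_K y : exists z, closure C y -> K z /\ rnorm (y - z) <= e / 2.
    have [Cy|nCy] := pselect (closure C y); last by exists 0.
    have ny : nbhs y [set z | rnorm (y - z) < e / 4].
      apply/nbhs_ballP; exists (e / 4)%:C; first by rewrite /= (_ : 0 = 0%:C)// ltcR.
      by move=> z; rewrite -ball_normE/= rnormE ltcR.
    have [c [Cc yc]] := Cy _ ny; have [z Kz cz] := CKe c Cc; exists z => _; split => //.
    by have := ler_rnormD (y - c) (c - z); rewrite addrA subrK; move: yc => /=; lra.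
  have [s sP] := choice near_K.
  have GK : (s @ F) K by rewrite /nbhs/=; apply: filterS FC => y /sP[].
  have [z0 [_ z0F]] := Kc _ (fmap_proper_filter s PF) GK.
  exists z0; pose A := [set y | rnorm (s y - z0) < e / 4].
  have [FA|FnA] := in_ultra_setVsetC A UF.
    apply: filterS (filterI FA FC) => y [/= sy /sP[_ ysy]].
    rewrite -ball_normE/= rnormE eE ltcR rdistC.
    have := ler_rnormD (y - s y) (s y - z0); rewrite addrA subrK; move: sy; rewrite /A/=; lra.
  have nz : nbhs z0 [set z | rnorm (z - z0) < e / 4].
    apply/nbhs_ballP; exists (e / 4)%:C; first by rewrite /= (_ : 0 = 0%:C)// ltcR.
    by move=> z; rewrite -ball_normE/= rnormE ltcR rdistC.
  have GnA : (s @ F) [set z | ~ rnorm (z - z0) < e / 4] by [].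
  by have [z []] := z0F _ _ GnA nz.
move=> /cvg_ex[p Fp]; exists p; split => //.
by apply: (@closed_closure _ C) => B /Fp FB; exact: filter_ex (filterI FC FB).
Qed.

Lemma compact_finite_sums (h : nat -> H) (r : R) N : exists2 K, compact K &
  forall c : nat -> R[i], (forall k, rnorm (c k) <= r) -> K (\sum_(0 <= k < N) c k *: h k).
Proof.
elim: N => [|N [K Kc Kh]].
  by exists [set 0]; [exact: compact_set1|move=> c _; rewrite big_geq].
pose f (z : H * (R * R)) : H := z.1 + (z.2.1 +i* z.2.2) *: h N.
exists (f @` (K `*` (`[- r, r] `*` `[- r, r]))).
  apply: continuous_compact; last first.
    by apply: compact_setX => //; apply: compact_setX; exact: segment_compact.
  apply: continuous_subspaceT => -[x [a b]]; apply/cvg_rnormP => e e0.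
  pose d := e / (1 + 2 * rnorm (h N)).
  have c0 : 0 < 1 + 2 * rnorm (h N) by rewrite ltr_pwDl// mulr_ge0 ?rnorm_ge0.
  have d0 : 0 < d by rewrite divr_gt0.
  exists ([set y | rnorm (x - y) < d], [set p : R * R | `|a - p.1| < d /\ `|b - p.2| < d]) => /=.
    split.
      apply/nbhs_ballP; exists d%:C; first by rewrite /= (_ : 0 = 0%:C)// ltcR.
      by move=> z; rewrite -ball_normE/= rnormE ltcR.
    exists (ball a d, ball b d); first by split; exact: nbhsx_ballx.
    by move=> [u v] /= []; rewrite -!ball_normE.
  move=> [y [u v]] /= [xy [au bv]].
  have -> : f (x, (a, b)) - f (y, (u, v)) = (x - y) + ((a - u) +i* (b - v)) *: h N.
    rewrite /f /= opprD addrACA -scalerBl; congr (_ + _ *: _).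
  apply: (le_lt_trans (ler_rnormD _ _)); rewrite rnormZ.
  have abd : rnorm ((a - u) +i* (b - v)) <= 2 * d.
    have -> : (a - u) +i* (b - v) = (a - u)%:C + 'i%C * (b - v)%:C.
      by rewrite [LHS]complexE.
    apply: (le_trans (ler_rnormD _ _)); rewrite rnormM !rnormR.
    have -> : rnorm ('i%C : R[i]) = 1 by rewrite /rnorm normc_def/= expr0n expr1n/= add0r sqrtr1.
    lra.
  have de : d * (1 + 2 * rnorm (h N)) = e by rewrite /d mulfVK// gt_eqF.
  have := rnorm_ge0 (h N); nra.
move=> c cr; rewrite big_nat_recr//=.
exists (\sum_(0 <= k < N) c k *: h k, (complex.Re (c N), complex.Im (c N))); last first.
  by rewrite /f /=; congr (_ + _ *: _); case: (c N).
split; first exact: Kh.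
have cN : (rnorm (c N)) ^+ 2 <= r ^+ 2.
  by rewrite ler_sqr ?nnegrE ?rnorm_ge0 ?cr// (le_trans _ (cr N)) ?rnorm_ge0.
have r0 : 0 <= r by apply: le_trans (cr N); exact: rnorm_ge0.
have cE : rnorm (c N) ^+ 2 = complex.Re (c N) ^+ 2 + complex.Im (c N) ^+ 2.
  by apply: complexI; rewrite rcX -rnormE add_Re2_Im2.
split; rewrite /= in_itv/= -ler_norml -(@ler_pXn2r _ 2)// ?nnegrE// real_normK ?num_real//.
  by have := sqr_ge0 (complex.Im (c N)); lra.
by have := sqr_ge0 (complex.Re (c N)); lra.
Qed.

(** The coefficients [<x, e k>] of the unit ball are bounded, so the first [N] terms
    stay in a compact set of finite sums; the tail has small operator norm. *)
Lemma series_op_compact M e h (A : {linear H -> H}) : bessel M e ->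
  (forall eps : R, 0 < eps -> exists N, bessel eps (fun k => if (k < N)%N then 0 else h k)) ->
  series_op ip e h A -> compact_op A.
Proof.
move=> eM htail eA; apply: precompact_approx => eps eps0.
have M0 := eM.1.
have d0 : 0 < eps ^+ 2 / (M + 1) by rewrite divr_gt0 ?exprn_gt0// ltr_wpDl.
have [N tail] := htail _ d0.
have [K Kc Kh] := compact_finite_sums h (Num.sqrt M) N.
exists K => // _ [x /= x1 <-]; exists (\sum_(0 <= k < N) ip x (e k) *: h k).
  pose c k := if (k < N)%N then ip x (e k) else 0.
  have -> : \sum_(0 <= k < N) ip x (e k) *: h k = \sum_(0 <= k < N) c k *: h k.
    by apply: eq_big_nat => k /andP[_ kN]; rewrite /c kN.
  apply: Kh => k; rewrite /c; case: ifP => _; last by rewrite rnorm0 sqrtr_ge0.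
  rewrite -(@ler_pXn2r _ 2)// ?nnegrE ?rnorm_ge0 ?sqrtr_ge0// sqr_sqrtr//.
  have := bessel_coef ip_norm x k k.+1 eM; rewrite big_nat1 => h1; apply: (le_trans h1).
  rewrite ler_piMr// expr_le1 ?rnorm_ge0//.
  by rewrite -lecR -rnormE.
have [T eT] := series_op_exists ip_norm eM tail.
have -> : A x - \sum_(0 <= k < N) ip x (e k) *: h k = T x.
  apply: cvg_uniqueH (eT x).
  have : (fun n => series (fun k => ip x (e k) *: h k) n - \sum_(0 <= k < N) ip x (e k) *: h k)
     @ \oo --> A x - \sum_(0 <= k < N) ip x (e k) *: h k.
    by apply: cvgB; [exact: eA|exact: cvg_cst].
  apply: cvg_trans; apply: near_eq_cvg; exists N => // n /= Nn.
  rewrite /series/= (big_cat_nat (n := N))//= [RHS](big_cat_nat (n := N))//=.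
  rewrite addrAC subrr add0r [X in _ = X + _]big_nat_cond [X in _ = X + _]big1 ?add0r.
    rewrite big_nat_cond [RHS]big_nat_cond; apply: eq_bigr => k /andP[/andP[Nk _] _].
    by rewrite ltnNge Nk.
  by move=> k /andP[/andP[_ ->] _]; rewrite scaler0.
have h1 := series_op_bound ip_norm eM tail eT x.
rewrite -(@ler_pXn2r _ 2)// ?nnegrE ?rnorm_ge0 ?(ltW eps0)//.
apply: (le_trans h1); rewrite mulrAC mulrA ler_pdivrMr ?ltr_wpDl//.
have x2 : rnorm x ^+ 2 <= 1 by rewrite expr_le1 ?rnorm_ge0// -lecR -rnormE.
have x20 : 0 <= 1 - rnorm x ^+ 2 by rewrite subr_ge0.
have := mulr_ge0 (mulr_ge0 M0 (sqr_ge0 eps)) x20; have := sqr_ge0 eps; nra.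
Qed.

Lemma diag_op_compact e (a : nat -> R) (A : {linear H -> H}) : orthosystem ip e ->
  a @ \oo --> 0 -> diag_op ip e a A -> compact_op A.
Proof.
move=> eo a0 eA; apply: (series_op_compact (orthosystem_bessel ip_norm eo) _ eA) => eps eps0.
move: a0 => /cvgrPdist_lt/(_ (Num.sqrt eps)); rewrite sqrtr_gt0 => /(_ eps0)[N _ aN].
exists N; have -> : (fun k => if (k < N)%N then 0 else (a k)%:C *: e k) =
    (fun k => ((if (k < N)%N then 0 else a k)%:C) *: e k).
  by apply/funext => k; case: ifP => // _; rewrite scale0r.
rewrite -[eps]sqr_sqrtr ?ltW//; apply: diag_bessel => // k.
case: ltnP => kN; first by rewrite normr0 sqrtr_ge0.
by have := aN k kN; rewrite /= sub0r normrN => /ltW.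
Qed.

End Compactness.

(** * Singular values *)

Section SingularValues.
Context {R : realType} {H : completeNormedModType R[i]}.
Variable ip : {dot H for @Num.conj R[i]}.
Hypothesis ip_norm : inner_product_norm ip.

Lemma finite_level_set (a : nat -> R) l : a @ \oo --> 0 -> 0 < l ->
  finite_set [set n | a n = l].
Proof.
move=> /cvgrPdist_lt a0 l0; have [N _ aN] := a0 l l0.
apply: (sub_finite_set (B := `I_N)); last exact: finite_II.
move=> n /= an; rewrite ltnNge; apply/negP => Nn.
by have := aN n Nn; rewrite /= an sub0r normrN gtr0_norm ?ltxx.
Qed.

Lemma orthosystem_indep e (s : seq nat) (c : 'I_(size s) -> R[i]) :
  orthosystem ip e -> uniq s -> (forall n, n \in s -> ip (e n) (e n) = 1) ->
  \sum_i c i *: e (nth 0%N s i) = 0 -> forall i, c i = 0.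
Proof.
move=> eo us s1 sum0 i.
have := congr1 (fun z => ip z (e (nth 0%N s i))) sum0.
rewrite ip0l ip_suml (bigD1 i)//= big1 ?addr0.
  by rewrite ipZl s1 ?mulr1// mem_nth.
move=> j ji; rewrite ipZl eo.1 ?mulr0// => /eqP; rewrite nth_uniq//.
by move/eqP/val_inj/eqP; rewrite (negbTE ji).
Qed.

(** The eigenspace of [l > 0] is spanned by the [e k] with [a k = l], because the
    coefficients of an eigenvector satisfy [a k <x, e k> = l <x, e k>]. *)
Lemma diag_op_singular_values e (a : nat -> R) (A : {linear H -> H}) :
  orthosystem ip e -> (forall k, 0 <= a k /\ (0 < a k -> ip (e k) (e k) = 1)) ->
  nonincreasing_seq a -> a @ \oo --> 0 -> diag_op ip e a A ->
  is_singular_values ip A a.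
Proof.
move=> eo ae a_decr a0 eA; split=> //; first by move=> n; have [] := ae n.
exists A.
  apply: (@diag_op_modulus_self _ _ ip ip_norm e a (a 0%N)) => // k.
  by have [-> _] := ae k; exact: a_decr.
move=> l l0; have fl := finite_level_set a0 l0.
pose X := fset_set [set n | a n = l]; pose s := enum_fset X.
have us : uniq s by exact: fset_uniq.
have sE n : (n \in s) = (a n == l).
  rewrite -[LHS]/(n \in X) /X in_fset_set//; apply/idP/eqP; first by move/set_mem.
  by move=> h; apply/mem_set.
exists (size s); last first.
  have := card_eq_fsetP (A := X) (n := size s); rewrite /X fset_setK// => h.
  exact/h.
exists (fun i => e (nth 0%N s i)); split.
  move=> c; apply: orthosystem_indep => // n; rewrite sE => /eqP an.
  by have [_] := ae n; apply; rewrite an.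
move=> x; split=> [/= Ax|[c ->]]; last first.
  rewrite /= linear_sum scaler_sumr; apply: eq_bigr => i _.
  rewrite linearZ/= (diag_op_eigen _ eo eA) !scalerA mulrC.
  by have := mem_nth 0%N (ltn_ord i); rewrite sE => /eqP ->.
exists (fun i => ip x (e (nth 0%N s i))).
have -> : \sum_(i < size s) ip x (e (nth 0%N s i)) *: e (nth 0%N s i) = \sum_(k <- s) ip x (e k) *: e k.
  by rewrite (big_nth 0%N) big_mkord.
have lC0 : l%:C != 0 by rewrite (_ : 0 = 0%:C)// (inj_eq (@complexI _)) gt_eqF.
apply: (scalerI lC0); rewrite -Ax scaler_sumr.
apply: (cvg_uniqueH (eA x)); apply: cvg_near_cst.
have [N sN] : exists N, forall k, k \in s -> (k < N)%N.
  exists (\max_(k <- s) k).+1 => k ks; rewrite ltnS; exact: leq_bigmax_seq.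
exists N => // n /= Nn; rewrite /series/=.
rewrite (bigID (mem s))/= [X in _ + X]big1 ?addr0; last first.
  move=> k; rewrite sE => akl.
  have := diag_op_coef ip_norm k x eo eA; rewrite Ax ipZl => /eqP.
  rewrite -subr_eq0 -mulrBl mulf_eq0 -rcB => /orP[/eqP/complexI/eqP|/eqP ->]; last by rewrite scale0r.
  by rewrite subr_eq0 eq_sym (negbTE akl).
rewrite -big_filter (perm_big s)/=; last first.
  apply: uniq_perm => //; first by rewrite filter_uniq// iota_uniq.
  move=> k; rewrite mem_filter mem_index_iota /=.
  by case ks: (k \in s) => //=; apply: leq_trans Nn; exact: sN.
apply: eq_big_seq => k; rewrite sE => /eqP ->.
by rewrite !scalerA mulrC.
Qed.

(** The coordinates of independent vectors in a basis form a matrix of full row rank. *)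
Lemma card_eigenvectors (W : set H) d e (s : seq nat) : orthosystem ip e ->
  has_dim W d -> uniq s -> (forall n, n \in s -> ip (e n) (e n) = 1 /\ W (e n)) ->
  (size s <= d)%N.
Proof.
move=> eo [b [_ bW]] us sW.
have [C CE] : exists C : 'M[R[i]]_(size s, d), forall i : 'I_(size s), e (nth 0%N s i) = \sum_j C i j *: b j.
  have h (i : 'I_(size s)) : exists c : 'I_d -> R[i], e (nth 0%N s i) = \sum_j c j *: b j.
    by apply/bW; have [] := sW _ (mem_nth 0%N (ltn_ord i)).
  have [f fP] := choice h; exists (\matrix_(i, j) f i j) => i.
  by rewrite fP; apply: eq_bigr => j _; rewrite mxE.
have /eqP <- : row_free C; last exact: rank_leq_col.
apply: inj_row_free => u uC.
apply/matrixP => i j; rewrite ord1 mxE.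
apply: (@orthosystem_indep e s (fun j => u 0 j)) => //; first by move=> n /sW[].
under eq_bigr do rewrite CE scaler_sumr.
rewrite exchange_big/= big1// => k _.
under eq_bigr do rewrite scalerA.
rewrite -scaler_suml; move/rowP: uC => /(_ k).
by rewrite !mxE => ->; rewrite scale0r.
Qed.

(** The square root of [V^2] is unique: if [T^2 x = v^2 x] with [T >= 0] and
    [v > 0] then [y = T x - v x] satisfies [T y = - v y], whence [y = 0]. *)
Lemma modulus_eigen (V T : {linear H -> H}) x v : is_adjoint ip V V -> is_modulus ip V T ->
  0 < v -> V x = v%:C *: x -> T x = v%:C *: x.
Proof.
move=> Vsa [_ Tpos [B VB TT]] v0 Vx.
have BV y : B y = V y.
  apply/subr0_eq/(ip_eq0 ip_norm); rewrite ipBr -VB Vsa subrr//.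
pose y := T x - v%:C *: x.
have Ty : T y = - (v%:C *: y).
  have -> : T y = T (T x) - v%:C *: T x by rewrite /y raddfB/= [T (_ *: _)]linearZ.
  by rewrite TT BV Vx [V _]linearZ/= Vx /y scalerBr opprB.
have := Tpos y; rewrite Ty ipNl ipZl (ip_rnorm ip_norm) -rcM -rcN ler0c oppr_ge0.
rewrite pmulr_rle0// => h; have /eqP : rnorm y ^+ 2 = 0 by apply/le_anti; rewrite h sqr_ge0.
by rewrite sqrf_eq0 => /eqP/rnorm_eq0/subr0_eq.
Qed.

(** Each positive eigenvalue occurs in [s] at least as often as in [v], which gives an
    injection [k |-> F (v k) k] of indices with [s (F (v k) k) = v k]. If [s n < v n]
    it would map [{0, ..., n}] into [{0, ..., n - 1}], as [s] is nonincreasing. *)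
Lemma eigenvalue_le_singular_value (V : {linear H -> H}) e (v s : nat -> R) :
  orthosystem ip e -> (forall k, 0 <= v k /\ (0 < v k -> ip (e k) (e k) = 1)) ->
  nonincreasing_seq v -> v @ \oo --> 0 -> diag_op ip e v V ->
  is_singular_values ip V s -> forall n, v n <= s n.
Proof.
move=> eo ve v_decr v0 eV [s0 s_decr [T Tmod sT]].
have Te k : 0 < v k -> T (e k) = (v k)%:C *: e k.
  move=> vk; apply: (modulus_eigen (diag_op_adjoint ip_norm eV)) => //.
  exact: diag_op_eigen eV.
have level_inj l : exists f : nat -> nat, 0 < l -> (forall k, v k = l -> s (f k) = l) /\
    (forall j k, v j = l -> v k = l -> f j = f k -> j = k).
  have [l0|_] := ltP 0 l; last by exists id.
  have [d Wd cd] := sT l l0; have fl := finite_level_set v0 l0.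
  pose X := fset_set [set n | v n = l].
  have XE n : (n \in X) = (v n == l).
    rewrite /X in_fset_set//; apply/idP/eqP; first by move/set_mem.
    by move=> h; apply/mem_set.
  have Xd : (size (enum_fset X) <= d)%N.
    apply: (card_eigenvectors (e := e) eo Wd) => [|n nX]; first exact: fset_uniq.
    have : v n == l by rewrite -XE.
    move=> /eqP vn; split; first by have [_] := ve n; apply; rewrite vn.
    by rewrite /= Te vn.
  have : ([set n | v n = l] #<= [set n | s n = l])%card.
    rewrite (card_le_eqr cd).
    have : ([set n | v n = l] #= `I_(size (enum_fset X)))%card.
      have := card_eq_fsetP (A := X) (n := size (enum_fset X)).
      rewrite {1}/X fset_setK// => h; exact/h.
    move=> h; rewrite (card_le_eql h) card_le_II//.
  move=> /pcard_leP[f].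
  exists f => _; split; first by move=> k vk; exact: (@funS _ _ _ _ f k vk).
  by move=> j k vj vk; apply: (@inj _ _ _ f) => //; exact: mem_set.
have [F FP] := choice level_inj.
move=> n; rewrite leNgt; apply/negP => sv.
have vpos k : (k <= n)%N -> 0 < v k.
  by move=> kn; apply: (lt_le_trans (le_lt_trans (s0 n) sv)); exact: v_decr.
have Fn (k : 'I_n.+1) : (F (v k) k < n)%N.
  have kn : (k <= n)%N by rewrite -ltnS.
  have [sF _] := FP (v k) (vpos _ kn); rewrite ltnNge; apply/negP => nF.
  have := s_decr _ _ nF; rewrite sF// leNgt => /negP; apply.
  exact: lt_le_trans sv (v_decr _ _ kn).
pose G (k : 'I_n.+1) : 'I_n := Ordinal (Fn k).
have Ginj : injective G.
  move=> j k /(congr1 val)/= jk; apply/val_inj => /=.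
  have jn : (j <= n)%N by rewrite -ltnS.
  have kn : (k <= n)%N by rewrite -ltnS.
  have [sFj Fj] := FP (v j) (vpos _ jn); have [sFk _] := FP (v k) (vpos _ kn).
  have vjk : v j = v k by rewrite -(sFj j)// jk sFk.
  by apply: Fj => //; rewrite jk vjk.
by have := leq_card G Ginj; rewrite !card_ord ltnn.
Qed.

End SingularValues.

(** * Spectral measures of diagonal operators *)

Lemma cvg_EFin_comp {R : realType} (u : nat -> R) s :
  u @ \oo --> s -> EFin \o u @ \oo --> s%:E.
Proof. by move=> us; apply: cvg_EFin; [exact: nearW|exact: us]. Qed.

Section DiscreteMeasure.
Context {R : realType}.
Variables (w : nat -> {nonneg R}) (p : nat -> R).

Definition atomic_measure : {measure set R -> \bar R} :=
  mseries (fun k => mscale (w k) (\d_(p k) : {measure set R -> \bar R})) 0.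

Lemma atomic_measureE X s : series (fun k => (w k)%:num * \1_X (p k)) @ \oo --> s ->
  atomic_measure X = s%:E.
Proof.
move=> ws; rewrite /atomic_measure/= /mseries.
apply/cvg_lim => //; move/cvg_EFin_comp: ws; apply: cvg_trans.
apply: near_eq_cvg; apply: nearW => n.
rewrite /series/= -sumEFin; apply: eq_bigr => k _.
by rewrite /mscale/= diracE indicE EFinM.
Qed.

(** The integrand may be negative off the atoms, as [id] is for a positive operator;
    only its values at the atoms matter. *)
Lemma integral_atomic_measure (f : R -> R) s : measurable_fun [set: R] f ->
  (forall k, 0 <= f (p k)) -> series (fun k => (w k)%:num * f (p k)) @ \oo --> s ->
  atomic_measure.-integrable setT (EFin \o f) /\
  (\int[atomic_measure]_t (f t)%:E = s%:E)%E.
Proof.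
move=> mf f0 fs.
have mEf : measurable_fun [set: R] (EFin \o f) by exact/measurable_EFinP.
have key (g : R -> \bar R) : (forall t, 0 <= g t)%E -> measurable_fun [set: R] g ->
    (\int[atomic_measure]_t g t = \sum_(0 <= k <oo) ((w k)%:num%:E * g (p k)))%E.
  move=> g0 mg; rewrite ge0_integral_measure_series//.
  apply: eq_eseriesr => k _; rewrite ge0_integral_mscale// integral_dirac//.
  by rewrite diracT mul1e.
have lims : (\sum_(0 <= k <oo) ((w k)%:num%:E * (f (p k))%:E) = s%:E)%E.
  apply/cvg_lim => //; move/cvg_EFin_comp: fs; apply: cvg_trans.
  apply: near_eq_cvg; apply: nearW => n.
  by rewrite /series/= -sumEFin; apply: eq_bigr => k _; rewrite EFinM.
split.
  apply/integrableP; split => //; rewrite key//; last exact: measurableT_comp.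
  suff -> : (\sum_(0 <= k <oo) ((w k)%:num%:E * `|(EFin \o f) (p k)|) = s%:E)%E by rewrite ltry.
  by rewrite -lims; apply: eq_eseriesr => k _; rewrite /= ger0_norm.
rewrite integralE key//; last exact: measurable_funepos.
rewrite key//; last exact: measurable_funeneg.
have -> : (\sum_(0 <= k <oo) ((w k)%:num%:E * (fun t => (f t)%:E)^\- (p k)) = 0)%E.
  apply: eseries0 => k _ _; rewrite funenegE max_r ?mule0//.
  by rewrite lee_fin oppr_le0.
rewrite sube0 -lims; apply: eq_eseriesr => k _.
by rewrite funeposE max_l// lee_fin.
Qed.

End DiscreteMeasure.

Section DiagonalSpectralMeasure.
Context {R : realType} {H : completeNormedModType R[i]}.
Variable ip : {dot H for @Num.conj R[i]}.
Hypothesis ip_norm : inner_product_norm ip.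
Variables (e : nat -> H) (a : nat -> R).
Hypothesis eo : orthosystem ip e.

(** The kernel of the operator carries the spectral value [0]: on the orthogonal
    complement of the [e k] the projection [E X] is the scalar [\1_X 0]. *)
Definition diag_indicator (X : set R) (E : {linear H -> H}) :=
  exists2 D : {linear H -> H},
    diag_op ip e (fun k => \1_X (a k) - \1_X 0) D &
    forall x, E x = (\1_X 0 : R)%:C *: x + D x.

Lemma indic_le1 (X : set R) t : 0 <= (\1_X t : R) <= 1.
Proof. by rewrite indicE; case: (t \in X); rewrite /= lexx ler01. Qed.

Lemma indic_diff_le1 (X : set R) s t : `|(\1_X s : R) - \1_X t| <= 1.
Proof. by rewrite ler_norml; have := indic_le1 X s; have := indic_le1 X t; lra. Qed.

Lemma diag_indicator_exists X : exists E, diag_indicator X E.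
Proof.
have [D eD _] := diag_op_exists ip_norm eo (fun k => indic_diff_le1 X (a k) 0).
pose f (x : H) := (\1_X 0 : R)%:C *: x + D x.
have fl : linear f.
  move=> c x y; have DP : D (c *: x + y) = c *: D x + D y by rewrite linearP.
  rewrite /f DP !scalerDr !scalerA [c * _]mulrC -!addrA.
  by congr (_ + _); rewrite addrCA.
pose fmix := GRing.isLinear.Build _ _ _ _ f fl.
pose E : {linear H -> H} := HB.pack_for {linear H -> H} f fmix.
by exists E, D.
Qed.

Section OneProjection.
Variables (X : set R) (E : {linear H -> H}).
Hypothesis XE : diag_indicator X E.

Lemma diag_indicator_bounded : bounded_op E.
Proof.
have [D eD ED] := XE.
have := diag_op_bounded ip_norm eo (fun k => indic_diff_le1 X (a k) 0) eD.
move=> /bounded_opP[M M0 DM]; apply: (@bounded_op_of _ _ _ (1 + M)) => x.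
rewrite ED (le_trans (ler_rnormD _ _))// rnormZ rnormR.
have := indic_le1 X 0 => /andP[i0 i1]; rewrite ger0_norm//.
have := DM x; have := rnorm_ge0 x; nra.
Qed.

Lemma diag_indicator_adjoint : is_adjoint ip E E.
Proof.
have [D eD ED] := XE; move=> x y.
by rewrite !ED ipDl ipDr ipZl ipZr cjR (diag_op_adjoint ip_norm eD).
Qed.

Lemma diag_indicator_coef x n : ip (E x) (e n) = (\1_X (a n) : R)%:C * ip x (e n).
Proof.
by have [D eD ED] := XE; rewrite ED ipDl ipZl (diag_op_coef ip_norm _ _ eo eD) rcB; ring.
Qed.

End OneProjection.

(** Coefficientwise this is [\1_(X `&` Y) = \1_X * \1_Y]. *)
Lemma diag_indicator_comp X Y (E F G : {linear H -> H}) :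
  diag_indicator X E -> diag_indicator Y F -> diag_indicator (X `&` Y) G ->
  forall x, G x = E (F x).
Proof.
move=> XE [D' eD' FE] [D'' eD'' GE] x.
have YF : diag_indicator Y F by exists D'.
have [D eD EE] := XE.
rewrite GE EE FE scalerDr scalerA -rcM.
rewrite (_ : (\1_X 0 : R) * \1_Y 0 = \1_(X `&` Y) 0); last by rewrite !indicE in_setI -natrM mulnb.
rewrite -addrA; congr (_ + _); apply: (cvg_uniqueH (eD'' x)).
have h : (fun n => (\1_X 0 : R)%:C *: series (fun k => ip x (e k) *: ((\1_Y (a k) - \1_Y 0)%:C *: e k)) n) @ \oo
    --> (\1_X 0 : R)%:C *: D' x by apply: cvgZr; exact: eD'.
have := eD (F x); rewrite FE => h'.
apply: (cvg_trans _ (cvgD h h')); apply: near_eq_cvg; apply: nearW => n.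
rewrite -FE fctE /series/= scaler_sumr -[LHS]big_split/=; apply: eq_bigr => k _.
rewrite (diag_indicator_coef YF) !scalerA -scalerDl; congr (_ *: _).
rewrite indicI !rcB !rcM /=; ring.
Qed.

Lemma diag_indicatorT (E : {linear H -> H}) : diag_indicator setT E -> forall x, E x = x.
Proof.
move=> [D eD ED] x; rewrite ED indicT scale1r.
suff -> : D x = 0 by rewrite addr0.
apply: (cvg_uniqueH (eD x)); apply: cvg_near_cst; apply: nearW => n.
by rewrite /series/= big1// => k _; rewrite !indicT subrr scale0r scaler0.
Qed.

Lemma diag_indicatorU X Y (E F G : {linear H -> H}) : X `&` Y = set0 ->
  diag_indicator X E -> diag_indicator Y F -> diag_indicator (X `|` Y) G ->
  forall x, G x = E x + F x.
Proof.
move=> XY0 [D eD EE] [D' eD' FE] [D'' eD'' GE] x.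
have iU t : (\1_(X `|` Y) t : R) = \1_X t + \1_Y t.
  have : (t \in X `&` Y) = false by rewrite XY0 in_set0.
  by rewrite !indicE in_setI in_setU; case: (t \in X); case: (t \in Y); rewrite //= ?addr0 ?add0r.
rewrite GE EE FE iU rcD scalerDl addrACA; congr (_ + _).
apply: (cvg_uniqueH (eD'' x)).
apply: (cvg_trans _ (cvgD (eD x) (eD' x))); apply: near_eq_cvg; apply: nearW => n.
rewrite fctE /series/= -[LHS]big_split/=; apply: eq_bigr => k _.
rewrite !scalerA -scalerDl; congr (_ *: _).
rewrite !iU !(rcB, rcD); ring.
Qed.

Section Distribution.
Variable x : H.

Let c k : R := rnorm (ip x (e k)) ^+ 2.

(** The limit falls short of [|x|^2] by the squared length of the component of [x]
    orthogonal to all [e k]. *)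
Lemma parseval_defect : exists2 s, s <= rnorm x ^+ 2 & series c @ \oo --> s.
Proof.
have cB n := bessel_coef ip_norm x 0 n (orthosystem_bessel ip_norm eo).
have c0 k : 0 <= c k by exact: sqr_ge0.
have cc : cvgn (series c).
  apply: nondecreasing_is_cvgn.
    by apply/nondecreasing_seqP => n; rewrite /series/= big_nat_recr//= lerDl.
  by exists (1 * rnorm x ^+ 2) => _ [n _ <-]; exact: cB.
exists (limn (series c)) => //; apply: limr_le => //.
by apply: nearW => n; rewrite -[leRHS]mul1r; exact: cB.
Qed.

Definition complement_weight : R := rnorm x ^+ 2 - limn (series c).

Lemma complement_weight_ge0 : 0 <= complement_weight.
Proof. by have [s sx cs] := parseval_defect; rewrite subr_ge0 (cvg_lim _ cs). Qed.

(** The atom of index [0] is the spectral value [0], with the weight of the component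
    orthogonal to all [e k]; the atom of index [k + 1] is [a k]. *)
Definition diag_weight k : {nonneg R} :=
  if k is k'.+1 then NngNum (sqr_ge0 (rnorm (ip x (e k')))) else NngNum complement_weight_ge0.

Definition diag_point k : R := if k is k'.+1 then a k' else 0.

Lemma diag_weight_series (g : R -> R) s : series (fun k => g (a k) * c k) @ \oo --> s ->
  series (fun k => (diag_weight k)%:num * g (diag_point k)) @ \oo --> complement_weight * g 0 + s.
Proof.
move=> gs; rewrite -cvg_shiftS.
apply: (cvg_trans _ (cvgD (cvg_cst (complement_weight * g 0)) gs)); apply: near_eq_cvg; apply: nearW => n.
rewrite fctE /series/= big_nat_recl//=; congr (_ + _).
by apply: eq_bigr => k _; rewrite mulrC.
Qed.

Lemma diag_spectral_distr (E : set R -> {linear H -> H}) :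
  (forall X, diag_indicator X (E X)) ->
  spectral_distr ip E x = atomic_measure diag_weight diag_point.
Proof.
move=> EX; apply/funext => X; rewrite /spectral_distr.
have [D eD ED] := EX X; have [_ Dq] := diag_op_quadratic ip_norm x eD.
have [s sx cs] := parseval_defect.
symmetry; apply: atomic_measureE.
have -> : complex.Re (ip (E X x) x) =
    complement_weight * \1_X 0 + (complex.Re (ip (D x) x) + \1_X 0 * s).
  rewrite ED ipDl raddfD/= ipZl (ip_rnorm ip_norm) -rcM/= /complement_weight (cvg_lim _ cs)//.
  ring.
apply: (diag_weight_series (g := \1_X)).
have h : (fun n => \1_X 0 * series c n) @ \oo --> \1_X 0 * s by apply: cvgMr.
apply: (cvg_trans _ (cvgD Dq h)); apply: near_eq_cvg; apply: nearW => n.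
rewrite fctE /series/= mulr_sumr -[LHS]big_split/=; apply: eq_bigr => k _.
rewrite /c; ring.
Qed.

End Distribution.

(** The spectral distribution of [x] is an atomic measure, hence countably additive;
    strong convergence follows since [|E Y x|^2] is the mass of [Y], and the mass of
    the remainder of the union tends to [0]. *)
Lemma diag_projection_valued (E : set R -> {linear H -> H}) :
  (forall X, diag_indicator X (E X)) -> projection_valued_measure ip E.
Proof.
move=> EX; split.
- move=> X _; split; [exact: diag_indicator_bounded (EX X)| |exact: diag_indicator_adjoint (EX X)].
  by move=> x; rewrite -(diag_indicator_comp (EX X) (EX X) (EX _)) setIid.
- exact: diag_indicatorT (EX setT).
- by move=> X Y _ _; exact: diag_indicator_comp.
move=> F mF tF x; set U := \bigcup_n F n.
have mU : measurable U by exact: bigcupT_measurable.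
pose m X := complex.Re (ip (E X x) x).
have mE X : (m X)%:E = atomic_measure (diag_weight x) (diag_point) X.
  by rewrite -(diag_spectral_distr x EX).
have msum : (\sum_(0 <= k < n) m (F k)) @[n --> \oo] --> m U.
  have := @measure_sigma_additive _ _ _ (atomic_measure (diag_weight x) diag_point) F mF tF.
  rewrite -mE => /fine_cvgP[_ h]; move: h; apply: cvg_trans.
  apply: near_eq_cvg; apply: nearW => n /=.
  by under eq_bigr do rewrite -mE; rewrite sumEFin.
(* splitting off the sets already summed *)
have Esum n : E U x = \sum_(0 <= k < n) E (F k) x + E (U `\` \bigcup_(k in `I_n) F k) x.
  elim: n => [|n IH]; first by rewrite big_geq// add0r bigcup_mkord big_ord0 setD0.
  rewrite big_nat_recr//= -addrA IH; congr (_ + _).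
  apply: (@diag_indicatorU (F n) (U `\` \bigcup_(k in `I_n.+1) F k) _ _ _ _ (EX _) (EX _)).
    rewrite setIDA; apply/seteqP; split => // t [[Fnt _] []]; exists n => //=.
  suff -> : F n `|` U `\` \bigcup_(k in `I_n.+1) F k = U `\` \bigcup_(k in `I_n) F k by exact: EX.
  apply/seteqP; split => t.
    case=> [Fnt|[Ut nt]]; split => //; first by exists n.
      move=> [k /= kn Fkt]; have nk : n = k by apply: tF => //; exists t.
      by move: kn; rewrite nk ltnn.
    by move=> [k /= kn Fkt]; apply: nt; exists k => //=; apply: ltnW.
  move=> [Ut nt]; have [Fnt|nFnt] := pselect (F n t); [by left|right; split => //].
  move=> [k /=]; rewrite ltnS leq_eqVlt => /predU1P[->//|kn] Fkt; apply: nt; by exists k.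
apply/cvg_rnormP => eps eps0.
have eps2 : 0 < eps ^+ 2 by rewrite exprn_gt0.
move: msum => /cvgrPdist_lt/(_ _ eps2); apply: filterS => n mn.
set Y := U `\` \bigcup_(k in `I_n) F k in Esum *.
have -> : E U x - \sum_(0 <= k < n) E (F k) x = E Y x by rewrite (Esum n) addrC addKr.
rewrite -(@ltr_pXn2r _ 2)// ?nnegrE ?rnorm_ge0 ?(ltW eps0)//.
apply: le_lt_trans mn.
have -> : m U - \sum_(0 <= k < n) m (F k) = m Y.
  rewrite /m (Esum n) ipDl raddfD/= ip_suml raddf_sum/= addrC addKr//.
have -> : m Y = rnorm (E Y x) ^+ 2.
  apply: complexI; rewrite -(ip_rnorm ip_norm) -(diag_indicator_adjoint (EX Y)).
  rewrite -(diag_indicator_comp (EX Y) (EX Y) (EX _)) setIid /m RRe_real//.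
  have <- : E Y (E Y x) = E Y x.
    by rewrite -(diag_indicator_comp (EX Y) (EX Y) (EX _)) setIid.
  by rewrite (diag_indicator_adjoint (EX Y)) (ip_rnorm ip_norm) ger0_real// ler0c sqr_ge0.
exact: ler_norm.
Qed.

Lemma diag_spectral_integral (E : set R -> {linear H -> H}) (f : R -> R) C (A : {linear H -> H}) :
  (forall X, diag_indicator X (E X)) -> measurable_fun [set: R] f -> f 0 = 0 ->
  (forall k, 0 <= f (a k) <= C) -> diag_op ip e (f \o a) A ->
  is_spectral_integral ip E f A.
Proof.
move=> EX mf f0 fa eA; split.
  by apply: (diag_op_bounded ip_norm (C := C) eo _ eA) => k /=; case/andP: (fa k) => ? ?; rewrite ger0_norm.
move=> x; rewrite (diag_spectral_distr x EX).
have [Ar Aq] := diag_op_quadratic ip_norm x eA.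
have := diag_weight_series (g := f) Aq; rewrite f0 mulr0 add0r => h.
have [|fi ->] := integral_atomic_measure mf _ h; first by case=> [|k] /=; rewrite ?f0//; case/andP: (fa k).
by split.
Qed.

Lemma diag_op_power r C (A P : {linear H -> H}) : 0 < r -> (forall k, 0 <= a k <= C) ->
  diag_op ip e a A -> diag_op ip e (fun k => a k `^ r) P -> is_op_power ip A r P.
Proof.
move=> r0 aC eA eP; have [E EX] := choice diag_indicator_exists.
exists E.
  split; first exact: diag_projection_valued.
  by apply: (diag_spectral_integral (C := C) EX).
apply: (diag_spectral_integral (C := C `^ r) EX) => //.
- by rewrite powR0// gt_eqF.
- move=> k; have /andP[h1 h2] := aC k; rewrite powR_ge0/=; apply: ge0_ler_powR; rewrite ?nnegrE ?(ltW r0)//.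
  exact: le_trans h1 h2.
Qed.

End DiagonalSpectralMeasure.

(** * Spectral subspaces of a given spectral measure *)

Section SpectralSubspace.
Context {R : realType} {H : completeNormedModType R[i]}.
Variable ip : {dot H for @Num.conj R[i]}.
Hypothesis ip_norm : inner_product_norm ip.
Variable E : set R -> {linear H -> H}.
Hypothesis pvm : projection_valued_measure ip E.

Lemma pvm_commute X Y x : measurable X -> measurable Y -> E X (E Y x) = E Y (E X x).
Proof. by case: pvm => _ _ EI _ mX mY; rewrite -!EI// setIC. Qed.

Lemma pvm_adjoint X : measurable X -> is_adjoint ip (E X) (E X).
Proof. by case: pvm => Ep _ _ _ /Ep[]. Qed.

Lemma pvm_idem X x : measurable X -> E X (E X x) = E X x.
Proof. by case: pvm => Ep _ _ _ /Ep[]. Qed.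

Lemma pvm_rnorm X x : measurable X -> spectral_distr ip E x X = (rnorm (E X x) ^+ 2)%:E.
Proof.
move=> mX; rewrite /spectral_distr; congr EFin.
by rewrite -(pvm_idem x mX) (pvm_adjoint mX) (ip_rnorm ip_norm) pvm_idem.
Qed.

Lemma pvm0 x : E set0 x = 0.
Proof.
case: pvm => _ _ _ sigma.
have triv : trivIset setT (fun _ : nat => set0 : set R) by move=> i j _ _ [t []].
have := sigma (fun=> set0) (fun=> measurable0) triv x.
rewrite bigcup0//; set u := (X in X @ \oo --> _) => ux.
have ux1 : (fun n => u n.+1) @ \oo --> E set0 x by rewrite cvg_shiftS.
have ux2 : (fun n => u n + E set0 x) @ \oo --> E set0 x + E set0 x.
  by apply: cvgD => //; exact: cvg_cst.
have : E set0 x = E set0 x + E set0 x.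
  apply: cvg_uniqueH ux2; apply: cvg_trans ux1; apply: near_eq_cvg; apply: nearW => n.
  by rewrite /u big_nat_recr.
by rewrite -{1}[E set0 x]addr0 => /addrI.
Qed.

(** On measurable sets this is the spectral distribution; unlike the latter, it is
    nonnegative on every set, as a measure has to be. *)
Lemma spectral_measure_exists x : exists nu : {measure set R -> \bar R},
  forall X, nu X = (rnorm (E X x) ^+ 2)%:E.
Proof.
pose nu X : \bar R := (rnorm (E X x) ^+ 2)%:E.
have nu0 : nu set0 = 0%E by rewrite /nu pvm0 rnorm0 expr0n.
have nu_ge0 X : (0 <= nu X)%E by rewrite lee_fin sqr_ge0.
have nu_sigma : semi_sigma_additive nu.
  move=> F mF tF mU; case: pvm => _ _ _ /(_ F mF tF x) Fx.
  have := cvg_EFin_comp (cvg_Re_ip (y := x) ip_norm Fx).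
  rewrite -[(complex.Re _)%:E]/(spectral_distr ip E x _) pvm_rnorm//.
  apply: cvg_trans; apply: near_eq_cvg; apply: nearW => n /=.
  rewrite ip_suml raddf_sum -sumEFin; apply: eq_bigr => k _ /=.
  by rewrite -[LHS]/(spectral_distr ip E x _) pvm_rnorm.
pose mix := @isMeasure.Build _ R R nu nu0 nu_ge0 nu_sigma.
by exists (HB.pack_for {measure set R -> \bar R} nu mix).
Qed.

Import HBNNSimple.

(** [spectral_distr] is only known to be a measure on measurable sets, so set
    functions of no particular kind are compared here. *)
Lemma eq_integral_measurable (m1 m2 : set R -> \bar R) (D : set R) (f : R -> \bar R) :
  (forall X, measurable X -> m1 X = m2 X) ->
  (\int[m1]_(t in D) f t = \int[m2]_(t in D) f t)%E.
Proof.
move=> m12; rewrite /integral.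
have sE (h : {nnsfun R >-> R}) : sintegral m1 h = sintegral m2 h.
  by apply: eq_fsbigr => r _; rewrite m12.
by congr (ereal_sup _ - ereal_sup _)%E; apply/seteqP; split => _ [h hf <-]; exists h.
Qed.

Variable V : {linear H -> H}.
Hypotheses (V_pos : positive_op ip V) (V_int : is_spectral_integral ip E id V).

Let q x := complex.Re (ip (V x) x).

Lemma quadratic_integral x (nu : {measure set R -> \bar R}) :
  (forall X, measurable X -> nu X = (rnorm (E X x) ^+ 2)%:E) ->
  nu.-integrable setT (EFin \o id) /\ (\int[nu]_t t%:E = (q x)%:E)%E.
Proof.
move=> nuE; have [xi xq] := V_int.2 x.
have dE X : measurable X -> spectral_distr ip E x X = nu X.
  by move=> mX; rewrite pvm_rnorm// nuE.
have ni : nu.-integrable setT (EFin \o id).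
  move: xi => /integrableP[mi ii]; apply/integrableP; split => //.
  by rewrite -(eq_integral_measurable _ _ dE).
split => //; rewrite /q xq /= (eq_integral_measurable _ _ dE) fineK//.
exact: integrable_fin_num ni.
Qed.

(** The spectral distribution of [x] is the sum of those of [E X x] and of
    [x - E X x], so that the quadratic form of [V] has no cross term. *)
Lemma quadratic_cross X x : measurable X ->
  complex.Re (ip (V (E X x)) (x - E X x)) = 0.
Proof.
move=> mX; set y := E X x; set z := x - y.
have [nx nxE] := spectral_measure_exists x.
have [ny nyE] := spectral_measure_exists y.
have [nz nzE] := spectral_measure_exists z.
have [ix qx] := quadratic_integral (fun X _ => nxE X).
have [iy qy] := quadratic_integral (fun X _ => nyE X).
have [iz qz] := quadratic_integral (fun X _ => nzE X).
have add Y : measurable Y -> nx Y = measure_add ny nz Y.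
  move=> mY; rewrite measure_addE nxE nyE nzE -EFinD; congr EFin.
  have -> : E Y x = E Y y + E Y z by rewrite -linearD /z addrC subrK.
  have cross : ip (E Y y) (E Y z) = 0.
    rewrite -(pvm_adjoint mY) pvm_idem// /y pvm_commute// (pvm_adjoint mX).
    by rewrite /z [E X _]raddfB/= /y pvm_idem// subrr ip0r.
  by rewrite (rnormD_sqr ip_norm) cross/= mulr0 addr0.
have := integral_measure_add measurableT iy iz.
rewrite -(eq_integral_measurable _ _ add) qx qy qz -EFinD => -[qyz].
have qD u w : q (u + w) = q u + q w + (complex.Re (ip (V u) w) + complex.Re (ip (V w) u)).
  by rewrite /q [V _]linearD !ipDl !ipDr !raddfD/=; ring.
have := qD y z; rewrite (_ : y + z = x); last by rewrite /z addrC subrK.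
have zy : complex.Re (ip (V z) y) = complex.Re (ip (V y) z).
  by rewrite (positive_op_selfadjoint V_pos) ipC; case: (ip _ _).
rewrite zy qyz; lra.
Qed.

(** Since [V] has no cross term between [y = E X x] and [x - y],
    [<V y, y> = <V x, y> = v <x, y> = v |y|^2]. *)
Lemma eigenvector_quadratic X x v : measurable X -> V x = v%:C *: x ->
  q (E X x) = v * rnorm (E X x) ^+ 2.
Proof.
move=> mX Vx; set y := E X x.
have := quadratic_cross x mX; rewrite -/y.
have -> : ip (V y) (x - y) = ip (V y) x - ip (V y) y by rewrite ipBr.
rewrite raddfB/= -/(q y) (positive_op_selfadjoint V_pos) Vx ipZr cjR.
rewrite /y -{1}(pvm_idem x mX) (pvm_adjoint mX) (ip_rnorm ip_norm) -rcM/= => h; lra.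
Qed.

(** The spectral distribution of [y] is carried by [X], so the integral of the
    identity lies between the bounds of [X], times [|y|^2]. *)
Lemma quadratic_bounds X y s : measurable X -> E X y = y ->
  ((forall l, X l -> s <= l) -> s * rnorm y ^+ 2 <= q y) /\
  ((forall l, X l -> l <= s) -> q y <= s * rnorm y ^+ 2).
Proof.
move=> mX Ey.
have [nu nuE] := spectral_measure_exists y.
have [iy qy] := quadratic_integral (fun X _ => nuE X).
have nuX : nu X = (rnorm y ^+ 2)%:E by rewrite nuE Ey.
have nuC : nu (~` X) = 0%E.
  case: pvm => _ _ EI _.
  by rewrite nuE -Ey -EI//; [rewrite setICl pvm0 rnorm0 expr0n|exact: measurableC].
have mid : measurable_fun setT (EFin \o (@id R)) by exact: measurable_int iy.
have qX : (\int[nu]_(t in X) t%:E = (q y)%:E)%E.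
  have mC : measurable (~` X) by exact: measurableC.
  have dC : [disjoint X & ~` X] by apply/disj_setPS; rewrite setICr.
  have mid' : measurable_fun (X `|` ~` X) (EFin \o (@id R)) by rewrite setUv.
  rewrite -qy -(setUv X) (integral_setU _ mX mC mid' dC).
  rewrite [X in (_ + X)%E]null_set_integral ?adde0//.
  exact: measurable_funTS.
have cst_int : (\int[nu]_(t in X) (cst s%:E) t = (s * rnorm y ^+ 2)%:E)%E.
  by rewrite integral_cst// nuX EFinM.
have is_ : nu.-integrable X (cst s%:E).
  apply/integrableP; split; first exact: measurable_cst.
  by rewrite -[X in (integral _ _ X < _)%E]/(cst `|s|%:E) integral_cst// nuX -EFinM ltry.
have iX : nu.-integrable X (EFin \o id) by apply: integrableS iy.
split=> Xs; rewrite -lee_fin -cst_int -qX; apply: le_integral => // l /set_mem Xl;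
  by rewrite lee_fin Xs.
Qed.

(** The component [y] of [x] in the range of [E `]s, +oo[] has [<V y, y> = v |y|^2]
    as well as [<V y, y> >= s |y|^2], hence vanishes as [v < s]; likewise below [0]. *)
Lemma spectral_subspace_eigenvector x (v s : R) : V x = v%:C *: x -> 0 < v < s ->
  E `[0, s] x = x.
Proof.
move=> Vx /andP[v0 vs].
have above : E `]s, +oo[ x = 0.
  have mX : measurable (`]s, +oo[ : set R) by exact: measurable_itv.
  have [+ _] := quadratic_bounds s mX (pvm_idem x mX).
  have hX l : `]s, +oo[%classic l -> s <= l.
    by rewrite /= in_itv/= andbT => /ltW.
  move=> /(_ hX).
  rewrite (eigenvector_quadratic mX Vx) => h; apply/rnorm_eq0/eqP.
  rewrite -sqrf_eq0 eq_le sqr_ge0 andbT leNgt; apply/negP => n0.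
  by move: h; rewrite ler_pM2r// leNgt vs.
have below : E `]-oo, 0[ x = 0.
  have mX : measurable (`]-oo, 0[ : set R) by exact: measurable_itv.
  have [_] := quadratic_bounds 0 mX (pvm_idem x mX).
  have hX l : `]-oo, 0[%classic l -> l <= (0 : R).
    by rewrite /= in_itv/= => /ltW.
  move=> /(_ hX).
  rewrite (eigenvector_quadratic mX Vx) mul0r => h; apply/rnorm_eq0/eqP.
  by rewrite -sqrf_eq0 eq_le sqr_ge0 andbT -(pmulr_rle0 _ v0).
have [nu nuE] := spectral_measure_exists x.
have mI : measurable (`[0, s] : set R) by exact: measurable_itv.
have nuI : nu setT = nu `[0, s]%classic.
  have -> : [set: R] = `[0, s]%classic `|` (`]s, +oo[%classic `|` `]-oo, 0[%classic).
    apply/seteqP; split => // t _ /=; rewrite !in_itv/= andbT.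
    by case: (leP 0 t) => t0; case: (leP t s) => ts; [left|right;left|right;right|right;right].
  have mU : measurable (`]s, +oo[%classic `|` `]-oo, 0[%classic : set R).
    by apply: measurableU; exact: measurable_itv.
  rewrite measureU//; last first.
    apply/seteqP; split => // t [] /=; rewrite !in_itv/= andbT => /andP[h1 h2] [h3|h3].
      by move: h2; rewrite leNgt h3.
    by move: h1; rewrite leNgt h3.
  rewrite measureU ?measurable_itv//; last first.
    apply/seteqP; split => // t [] /=; rewrite !in_itv/= andbT => h1 h2.
    by have := lt_trans (lt_trans v0 vs) (lt_trans h1 h2); rewrite ltxx.
  have nu1 : nu `]s, +oo[%classic = 0%E by rewrite nuE above rnorm0 expr0n.
  have nu2 : nu `]-oo, 0[%classic = 0%E by rewrite nuE below rnorm0 expr0n.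
  by rewrite [X in (_ + (X + _))%E]nu1 [X in (_ + (_ + X))%E]nu2 !adde0.
apply/esym/subr0_eq/rnorm_eq0/eqP; rewrite -sqrf_eq0; apply/eqP.
have c : ip x (E `[0, s]%classic x) = (rnorm (E `[0, s]%classic x) ^+ 2)%:C.
  by rewrite -(ip_rnorm ip_norm) (pvm_adjoint mI) pvm_idem.
rewrite (rnormD_sqr ip_norm) rnormN ipNr c.
by move: nuI; rewrite !nuE => -[]; case: (pvm) => _ -> _ _ ->; rewrite /=; ring.
Qed.

End SpectralSubspace.

(** * Regularly varying functions *)

Section RegularVariation.
Context {R : realType}.
Variable phi : R -> R.
Hypothesis phi_gt0 : forall t, 0 <= t -> 0 < phi t.
Hypothesis phi_decr : forall s t, 0 <= s -> s <= t -> phi t <= phi s.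
Hypothesis phi_rv : regularly_varying (-1) phi.

Let eq_ler (x y : R) : x = y -> x <= y. Proof. by move=> ->. Qed.

Lemma rv_ratio (l : R) : 0 < l -> exists2 T, 0 < T & forall t, T <= t ->
  phi (l * t) <= 2 * l^-1 * phi t /\ phi t <= 2 * l * phi (l * t).
Proof.
move=> l0; have [_ /(_ l l0)] := phi_rv; rewrite powR_inv1 ?ltW// => /cvgrPdist_lt.
have il0 : 0 < l^-1 by rewrite invr_gt0.
have h0 : 0 < l^-1 / 2 by rewrite divr_gt0.
move=> /(_ _ h0)[M [_ hM]]; exists (`|M| + 1); first by rewrite ltr_wpDl.
move=> t tM; have t0 : 0 <= t by apply: le_trans tM; rewrite addr_ge0.
have pt := phi_gt0 t0.
have /hM : M < t by apply: lt_le_trans tM; rewrite (le_lt_trans (ler_norm _))// ltrDl.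
rewrite /= ltr_norml => /andP[h1 h2].
set r := phi (l * t) / phi t in h1 h2.
have rE : phi (l * t) = r * phi t by rewrite /r divfK// gt_eqF.
rewrite rE; split; first by rewrite ler_pM2r//; lra.
have : 2^-1 <= l * r.
  rewrite -(ler_pM2l il0) mulrA mulVf ?gt_eqF// mul1r; lra.
move=> h; have -> : 2 * l * (r * phi t) = 2 * (l * r) * phi t by ring.
by rewrite -[leLHS]mul1r ler_pM2r//; move: (l * r) h => lr; lra.
Qed.

(** The limit of the ratio is [1 / 2]; any constant between [1 / 2] and [1 / sqrt 2]
    would make the dyadic sums of [dyadic_tail] converge. *)
Lemma rv_double : exists2 T, 0 < T & forall t, T <= t -> phi (2 * t) <= 3 / 5 * phi t.
Proof.
have [_ /(_ _ (ltr0Sn R 1))] := phi_rv; rewrite powR_inv1// => /cvgrPdist_lt.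
have h0 : 0 < 10^-1 :> R by rewrite invr_gt0.
move=> /(_ _ h0)[M [_ hM]]; exists (`|M| + 1); first by rewrite ltr_wpDl.
move=> t tM; have t0 : 0 <= t by apply: le_trans tM; rewrite addr_ge0.
have pt := phi_gt0 t0.
have /hM : M < t by apply: lt_le_trans tM; rewrite (le_lt_trans (ler_norm _))// ltrDl.
by rewrite /= ltr_norml -ler_pdivrMr// => /andP[]; lra.
Qed.

(** Iterating [phi (2 t) <= 3 / 5 phi t] gives geometric decay along a dyadic sequence. *)
Lemma rv_vanish (d : R) : 0 < d -> exists2 T, 0 < T & forall t, T <= t -> phi t < d.
Proof.
move=> d0; have [T T0 hT] := rv_double.
have pow k : phi (2 ^+ k * T) <= (3 / 5) ^+ k * phi T.
  elim: k => [|k IH]; first by rewrite !expr0 !mul1r.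
  rewrite !exprS -[2 * _ * _]mulrA -[leRHS]mulrA; apply: (le_trans (hT _ _)).
    by rewrite ler_peMl ?(ltW T0)// exprn_ege1// ler1n.
  by rewrite ler_pM2l// divr_gt0.
have pT : 0 < phi T by apply: phi_gt0; exact: ltW.
have : (fun k => (3 / 5) ^+ k : R) @ \oo --> 0.
  by apply: cvg_expr; rewrite ger0_norm; lra.
move=> /cvgrPdist_lt/(_ (d / phi T)); rewrite divr_gt0// => /(_ isT)[k _ /(_ k (leqnn k))/=].
rewrite sub0r normrN ger0_norm ?exprn_ge0 ?divr_ge0// ltr_pdivlMr// => hk.
exists (2 ^+ k * T); first by rewrite mulr_gt0// exprn_gt0.
move=> t ht; apply: le_lt_trans hk; apply: le_trans (pow k).
by apply: phi_decr => //; rewrite mulr_ge0 ?exprn_ge0// ltW.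
Qed.

Lemma phi_inv_phi : invertible_near0 phi ->
  exists2 T, 0 < T & forall t, T <= t -> phi_inv phi (phi t) = t.
Proof.
move=> [d /= d0 hd]; have [T T0 hT] := rv_vanish d0.
exists T => // t tT; have t0 : 0 <= t by apply: le_trans tT; exact: ltW.
have := hd (phi t); rewrite /= sub0r normrN gtr0_norm ?phi_gt0// => /(_ (hT _ tT) isT)[x [_ hx]].
rewrite /phi_inv; have h : [set y | 0 <= y /\ phi y = phi t] t by [].
have [y0 yE] := xgetI 0 h; exact: (etrans (esym (hx _ (conj y0 yE))) (hx _ h)).
Qed.

(** The form in which the condition on [phi_inv] is used: at the point [1 / phi t]. *)
Lemma W1_composition : invertible_near0 phi -> property_W1 phi ->
  exists2 C, 0 < C & exists2 T, 0 < T & forall t, T <= t ->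
    phi (phi t)^-1 <= C * t * phi t ^+ 2.
Proof.
move=> phi_invertible [C1 C10 [M [_ hM]]]; exists C1^-1; first by rewrite invr_gt0.
have [T T0 hT] := phi_inv_phi phi_invertible.
have [T' T'0 hT'] := @rv_vanish (`|M| + 1)^-1 (ltac:(by rewrite invr_gt0 ltr_wpDl)).
exists (T + T'); first by rewrite addr_gt0.
move=> t tT; have t0 : 0 <= t by apply: le_trans tT; rewrite addr_ge0 ?ltW.
have pt := phi_gt0 t0.
have /hM : M < (phi t)^-1.
  apply: (le_lt_trans (ler_norm _)); apply: (@lt_trans _ _ (`|M| + 1)); first by rewrite ltrDl.
  rewrite -[ltLHS]invrK ltf_pV2 ?posrE ?invr_gt0 ?ltr_wpDl//.
  by apply: hT'; apply: le_trans tT; rewrite lerDr ltW.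
rewrite invrK hT; last by apply: le_trans tT; rewrite lerDl ltW.
move=> h; rewrite -(ler_pM2l C10).
have -> : C1 * (C1^-1 * t * phi t ^+ 2) = t * phi t ^+ 2 by field; rewrite gt_eqF.
rewrite -ler_pdivrMr ?exprn_gt0//; apply: le_trans h; rewrite exprVn.
by apply: eq_ler; ring.
Qed.

(** Splitting dyadically, the weight [v_k^-1/2] on [s 2^(-j-1) <= v_k < s 2^-j]
    costs a factor [2^(j/2)], while [phi] contributes the factor [(3/5)^j], and
    [sqrt 2 * 3/5 < 1]. The induction passes from [s / 2] to [s]; with the bound
    [sqrt 2 <= 3 / 2] it closes for any constant [c] such that
    [3/2 (3/5 c + C) <= c], for instance [c = 15 C]. *)
Lemma dyadic_tail (v w : nat -> R) C : 0 <= C -> (forall k, 0 <= w k) ->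
  (forall t M, 0 < t -> \sum_(0 <= k < M | 0 < v k < t^-1) w k <= C * phi t) ->
  exists2 s0, 0 < s0 & forall s M, 0 < s <= s0 ->
    \sum_(0 <= k < M | 0 < v k < s) (Num.sqrt (v k))^-1 * w k
      <= 15 * C * (phi s^-1 / Num.sqrt s).
Proof.
move=> C0 w0 tail; have [T T0 hT] := rv_double.
exists T^-1; first by rewrite invr_gt0.
move=> s M /andP[spos ss0].
(* A positive lower bound of the finitely many nonzero [v k] starts the induction. *)
have [sg sg0 sgv] : exists2 sg, 0 < sg & forall k, (k < M)%N -> 0 < v k -> sg <= v k.
  elim: M => [|M [sg sg0 sgv]]; first by exists 1.
  have [vM|vM] := ltP 0 (v M).
    exists (Num.min sg (v M)); first by rewrite lt_min sg0.
    move=> k; rewrite ltnS leq_eqVlt => /predU1P[->|kM] vk; first by rewrite ge_min lexx orbT.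
    by rewrite ge_min sgv.
  exists sg => // k; rewrite ltnS leq_eqVlt => /predU1P[->|kM]; last exact: sgv.
  by rewrite ltNge vM.
have [j] : exists j, s <= 2 ^+ j * sg.
  have [j hj] : exists j, s / sg <= 2 ^+ j.
    exists (Num.bound (s / sg)).
    have := archi_boundP (divr_ge0 (ltW spos) (ltW sg0)) => /ltW h; apply: (le_trans h).
    by rewrite -natrX ler_nat ltnW// ltn_expl.
  by exists j; rewrite -ler_pdivrMr.
elim: j s spos ss0 => [|j IH] s spos ss0 sj.
  rewrite big_nat_cond big1 ?mulr_ge0 ?invr_ge0 ?sqrtr_ge0// ?(ltW (phi_gt0 _)) ?invr_ge0 ?ltW//.
  move=> k /andP[/andP[_ kM] /andP[v0 vs]].
  by move: vs; rewrite ltNge (le_trans _ (sgv k kM v0))// -[leRHS]mul1r -(expr0 2).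
pose h := s / 2; have h0 : 0 < h by rewrite divr_gt0.
have hs : h < s by rewrite /h; lra.
have hE : h^-1 = 2 * s^-1 by rewrite /h invf_div mulrC.
have IHh : \sum_(0 <= k < M | 0 < v k < h) (Num.sqrt (v k))^-1 * w k
    <= 15 * C * (phi h^-1 / Num.sqrt h).
  apply: IH => //; first by lra.
  by rewrite /h ler_pdivrMr// mulrAC -exprSr.
have sT : T <= s^-1 by rewrite -[T]invrK lef_pV2 ?posrE ?invr_gt0.
have phih := hT _ sT; rewrite -hE in phih.
have s1 := tail s^-1 M (ltac:(by rewrite invr_gt0)); rewrite invrK in s1.
have sh0 : 0 < Num.sqrt h by rewrite sqrtr_gt0.
have split : \sum_(0 <= k < M | 0 < v k < s) (Num.sqrt (v k))^-1 * w k <=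
    \sum_(0 <= k < M | 0 < v k < h) (Num.sqrt (v k))^-1 * w k
    + (Num.sqrt h)^-1 * \sum_(0 <= k < M | 0 < v k < s) w k.
  rewrite mulr_sumr big_mkcond [X in X + _]big_mkcond [X in _ + X]big_mkcond -big_split/=.
  apply: ler_sum => k _; have [v0|v0] := ltP 0 (v k); rewrite /= ?addr0//.
  have [vs|vs] := ltP (v k) s; have [vh|vh] := ltP (v k) h.
  - by rewrite lerDl mulr_ge0 ?invr_ge0 ?sqrtr_ge0.
  - by rewrite add0r ler_wpM2r// lef_pV2 ?posrE ?sqrtr_gt0// ler_wsqrtr.
  - by move: (lt_trans vh hs); rewrite ltNge vs.
  - by rewrite addr0.
have sq : (Num.sqrt h)^-1 <= 3 / 2 * (Num.sqrt s)^-1.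
  have ss : 0 < Num.sqrt s by rewrite sqrtr_gt0.
  rewrite -[leLHS]mul1r ler_pdivrMr// mulrAC ler_pdivlMr// mul1r.
  rewrite -(@ler_pXn2r _ 2)// ?nnegrE ?mulr_ge0 ?sqrtr_ge0// exprMn !sqr_sqrtr ?(ltW h0) ?(ltW spos)//.
  rewrite /h; lra.
have p0 : 0 < phi s^-1 by apply: phi_gt0; rewrite invr_ge0 ltW.
have ish0 : 0 < (Num.sqrt h)^-1 by rewrite invr_gt0.
apply: (le_trans split).
apply: (@le_trans _ _ (10 * C * (phi s^-1 * (Num.sqrt h)^-1))).
  apply: (@le_trans _ _ (15 * C * (3 / 5 * phi s^-1 / Num.sqrt h) + (Num.sqrt h)^-1 * (C * phi s^-1))).
    apply: lerD; last by rewrite ler_pM2l.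
    apply: (le_trans IHh); rewrite ler_wpM2l ?mulr_ge0//.
    by rewrite ler_pM2r.
  by apply: eq_ler; field; rewrite gt_eqF.
apply: (@le_trans _ _ (10 * C * (phi s^-1 * (3 / 2 * (Num.sqrt s)^-1)))).
  by rewrite ler_wpM2l ?mulr_ge0// ler_pM2l.
by apply: eq_ler; field; rewrite gt_eqF// sqrtr_gt0.
Qed.

End RegularVariation.

(** * Singular values of Hilbert-Schmidt operators *)

Section HilbertSchmidt.
Context {R : realType} {H : completeNormedModType R[i]}.
Variable ip : {dot H for @Num.conj R[i]}.
Hypothesis ip_norm : inner_product_norm ip.

Lemma series_op_apply e h (A : {linear H -> H}) k : orthosystem ip e ->
  series_op ip e h A -> (e k = 0 -> h k = 0) -> A (e k) = h k.
Proof.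
move=> eo eA h0; apply: (cvg_uniqueH (eA _)); apply: cvg_near_cst.
exists k.+1 => // m /= km; rewrite /series/= (big_rem k)/= ?mem_index_iota//=.
rewrite big1_seq ?addr0; last first.
  move=> j; rewrite (rem_filter _ (iota_uniq _ _)) mem_filter /= => /andP[/eqP jk _].
  by rewrite eo.1 ?scale0r// => kj; apply: jk.
by case: (eo.2 k) => [->|ek]; [rewrite scale1r|rewrite h0// scaler0].
Qed.

(** With the orthonormal [u i = l_i^(-1/2) B (f i)] one has
    [<u i, g k> = l_i^(1/2) <f i, e k>]; summing squares over [i <= m] and
    [k >= n] and using Bessel's inequality in both indices gives the bound.
    It plays the part of the inequality between the singular value of index
    [m] and the Hilbert-Schmidt distance to the operators of rank [n]. *)
Lemma singular_value_tail_bound e g f (l : nat -> R) (B Bt S : {linear H -> H}) tau n m :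
  orthosystem ip e -> (forall k, e k = 0 -> g k = 0) -> series_op ip e g B -> is_adjoint ip B Bt ->
  orthosystem ip f -> (forall k, 0 <= l k /\ (0 < l k -> ip (f k) (f k) = 1)) ->
  nonincreasing_seq l -> diag_op ip f l S -> (forall x, Bt (B x) = S x) -> 0 <= tau ->
  (forall M, \sum_(n <= k < M) rnorm (g k) ^+ 2 <= tau) ->
  l m * (m.+1%:R - n%:R) <= tau.
Proof.
move=> eo g0 eB BBt fo lf l_decr fS BS tau0 tau_ge.
have [lm0|lm0] := leP (l m) 0.
  have [lm _] := lf m; have -> : l m = 0 by apply/le_anti; rewrite lm0 lm.
  by rewrite mul0r.
have lpos i : (i <= m)%N -> 0 < l i by move=> im; apply: lt_le_trans lm0 _; exact: l_decr.
have Sf i : S (f i) = (l i)%:C *: f i by exact: diag_op_eigen fS.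
have Bff i j : ip (B (f i)) (B (f j)) = (l i)%:C * ip (f i) (f j).
  have := diag_op_adjoint ip_norm fS (f i) (f j).
  by rewrite -[S (f j)]BS -BBt => <-; rewrite Sf ipZl.
have Bfg i k : ip (B (f i)) (g k) = (l i)%:C * ip (f i) (e k).
  rewrite -(series_op_apply eo eB (g0 k)) BBt BS.
  by rewrite -(diag_op_adjoint ip_norm fS) Sf ipZl.
pose u i := if (i <= m)%N then (Num.sqrt (l i))^-1%:C *: B (f i) else 0.
have uo : orthosystem ip u.
  split=> [i j ij|i]; rewrite /u.
    case: ifP => _; last by rewrite ip0l.
    by case: ifP => _; rewrite ?ip0r// ipZl ipZr Bff fo.1// !mulr0.
  case: ifP => im; last by right.
  left; rewrite ipZl ipZr cjR Bff (lf i).2 ?lpos// mulr1 -!rcM.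
  have := lpos i im => li.
  by rewrite -{3}(sqr_sqrtr (ltW li)) expr2 mulKf ?gt_eqF ?sqrtr_gt0// mulVf// gt_eqF ?sqrtr_gt0.
pose c i k : R := rnorm (ip (f i) (e k)) ^+ 2.
have c0 i k : 0 <= c i k by exact: sqr_ge0.
have ug i k : (i <= m)%N -> rnorm (ip (g k) (u i)) ^+ 2 = l i * c i k.
  move=> im; have li := lpos i im.
  rewrite ipC rnorm_conj /u im ipZl Bfg !rnormM !rnormR !ger0_norm ?invr_ge0 ?sqrtr_ge0 ?ltW//.
  rewrite !exprMn -/(c i k) mulrA; congr (_ * _).
  by rewrite exprVn sqr_sqrtr ?(ltW li)// expr2 mulKf ?gt_eqF.
have cB k N : \sum_(0 <= i < N) c i k <= 1.
  have := bessel_coef ip_norm (e k) 0 N (orthosystem_bessel ip_norm fo).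
  rewrite mul1r => h; apply: (@le_trans _ _ (rnorm (e k) ^+ 2)); last first.
    by rewrite expr_le1 ?rnorm_ge0// (orthosystem_rnorm ip_norm).
  apply: le_trans h; apply: ler_sum => i _; by rewrite /c ipC rnorm_conj.
have cg i : (i <= m)%N -> series (c i) @ \oo --> (1 : R).
  move=> im; have li := lpos i im.
  have := cvg_Re_ip (y := B (f i)) ip_norm (eB (f i)).
  have -> : complex.Re (ip (B (f i)) (B (f i))) = l i by rewrite Bff (lf i).2// mulr1.
  move=> h; have h' : (fun M => (l i)^-1 * complex.Re (ip
      (series (fun k => ip (f i) (e k) *: g k) M) (B (f i)))) @ \oo --> (l i)^-1 * l i.
    by apply: cvgMr.
  rewrite mulVf ?gt_eqF// in h'; apply: cvg_trans h'; apply: near_eq_cvg; apply: nearW => M.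
  rewrite /series/= ip_suml raddf_sum mulr_sumr; apply: eq_bigr => k _ /=.
  rewrite ipZl [ip (g k) _]ipC Bfg cjM cjR mulrCA -rnorm_sqrE -rcM/= mulKf ?gt_eqF//.
apply/ler_addgt0Pl => eps eps0.
pose d := eps / (l m * m.+1%:R).
have lm1 : 0 < l m * m.+1%:R by rewrite mulr_gt0.
have d0 : 0 < d by rewrite divr_gt0.
have nearM : \forall M \near \oo, forall i : 'I_m.+1, 1 - d <= series (c i) M.
  apply: filter_forall => i; have im : (i <= m)%N by rewrite -ltnS.
  have := cg i im => /cvgrPdist_le/(_ d d0); apply: filterS => M.
  by rewrite ler_norml => /andP[_]; rewrite lerBlDr addrC -lerBlDr.
have [M [nM cM]] : exists M, (n <= M)%N /\ forall i : 'I_m.+1, 1 - d <= series (c i) M.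
  have [M [h1 h2]] := filter_ex (filterI nearM (nbhs_infty_ge n)); by exists M.
have upper : \sum_(0 <= i < m.+1) l i * (\sum_(n <= k < M) c i k) <= tau.
  apply: le_trans (tau_ge M).
  under eq_bigr do rewrite mulr_sumr.
  rewrite exchange_big/=; apply: ler_sum => k _.
  have := bessel_coef ip_norm (g k) 0 m.+1 (orthosystem_bessel ip_norm uo).
  rewrite mul1r; apply: le_trans; rewrite big_nat_cond [leRHS]big_nat_cond.
  by apply: ler_sum => i /andP[/andP[_ im] _]; rewrite ug.
have lower : l m * (m.+1%:R * (1 - d) - n%:R) <=
    \sum_(0 <= i < m.+1) l i * (\sum_(n <= k < M) c i k).
  apply: (@le_trans _ _ (\sum_(0 <= i < m.+1) l m * (\sum_(n <= k < M) c i k))); last first.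
    rewrite big_nat_cond [leRHS]big_nat_cond; apply: ler_sum => i /andP[/andP[_ im] _].
    by rewrite ler_wpM2r ?sumr_ge0// l_decr.
  rewrite -mulr_sumr ler_pM2l//.
  have -> : \sum_(0 <= i < m.+1) \sum_(n <= k < M) c i k =
     \sum_(0 <= i < m.+1) series (c i) M - \sum_(0 <= k < n) \sum_(0 <= i < m.+1) c i k.
    rewrite [X in _ - X]exchange_big -sumrB; apply: eq_bigr => i _.
    by rewrite /series/= [X in _ = X - _](big_cat_nat (n := n))//= addrAC subrr add0r.
  apply: lerB.
    rewrite -[m.+1%:R](_ : \sum_(0 <= i < m.+1) (1 : R) = _); last by rewrite sumr_const_nat subn0.
    rewrite mulr_suml big_mkord [leRHS]big_mkord; apply: ler_sum => i _.
    by rewrite mul1r; exact: cM.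
  rewrite -[n%:R](_ : \sum_(0 <= k < n) (1 : R) = _); last by rewrite sumr_const_nat subn0.
  by apply: ler_sum => k _; exact: cB.
have dE : d * (l m * m.+1%:R) = eps by rewrite /d mulfVK// gt_eqF.
have := le_trans lower upper; rewrite -{}dE.
have -> : l m * (m.+1%:R * (1 - d) - n%:R) = l m * (m.+1%:R - n%:R) - d * (l m * m.+1%:R) by ring.
by rewrite lerBlDl.
Qed.

End HilbertSchmidt.

(** * Decay of the singular values *)

Section Decay.
Context {R : realType}.
Variable phi : R -> R.
Hypothesis phi_gt0 : forall t, 0 <= t -> 0 < phi t.
Hypothesis phi_decr : forall s t, 0 <= s -> s <= t -> phi t <= phi s.
Hypothesis phi_rv : regularly_varying (-1) phi.
Hypothesis phi_invertible : invertible_near0 phi.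
Hypothesis phi_W1 : property_W1 phi.

Definition tail_bounded (a : nat -> R) n tau := forall M, \sum_(n <= k < M) a k <= tau.

(** Since [v k <= K phi n] for [k >= n], the dyadic estimate applies with
    [s = 2 K phi n] and bounds the tail by a multiple of
    [phi (1 / phi n) / sqrt (phi n)]; the condition on [phi_inv] turns
    [phi (1 / phi n)] into [n (phi n)^2]. *)
Lemma weighted_tail (v w a : nat -> R) C K : 0 <= C -> 0 < K ->
  (forall k, 0 <= v k <= K * phi k%:R) ->
  (forall k, 0 <= w k) -> (forall k, a k = if 0 < v k then (Num.sqrt (v k))^-1 * w k else 0) ->
  (forall t M, 0 < t -> \sum_(0 <= k < M | 0 < v k < t^-1) w k <= C * phi t) ->
  exists2 c, 0 <= c & exists2 N, (0 < N)%N & forall n, (N <= n)%N ->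
    tail_bounded a n (c * n%:R * (phi n%:R * Num.sqrt (phi n%:R))).
Proof.
move=> C0 K0 vK w0 aE tail.
have [s0 s00 dy] := dyadic_tail phi_gt0 phi_rv C0 w0 tail.
have K20 : 0 < 2 * K by rewrite mulr_gt0.
have iK0 : 0 < (2 * K)^-1 by rewrite invr_gt0.
have [T T0 ratio] := rv_ratio phi_gt0 phi_rv iK0.
have [c1 c10 [T1 T10 comp]] := W1_composition phi_gt0 phi_decr phi_rv phi_invertible phi_W1.
have s1pos : 0 < s0 / (2 * K) by rewrite divr_gt0.
have iT0 : 0 < T^-1 by rewrite invr_gt0.
have [T2 T20 small1] := rv_vanish phi_gt0 phi_decr phi_rv s1pos.
have [T3 T30 small2] := rv_vanish phi_gt0 phi_decr phi_rv iT0.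
pose c2 := 2 * (2 * K).
exists (15 * C * (c2 * c1 * (Num.sqrt (2 * K))^-1)).
  by rewrite !mulr_ge0 ?invr_ge0 ?sqrtr_ge0 ?(ltW c10) ?(ltW K0).
exists (Num.bound (T1 + T2 + T3)).+1 => // n nN M.
have nT : T1 + T2 + T3 <= n%:R.
  apply: (@le_trans _ _ (Num.bound (T1 + T2 + T3))%:R).
    by rewrite ltW// archi_boundP// !addr_ge0 ?ltW.
  by rewrite ler_nat ltnW.
have n0 : 0 <= n%:R :> R by exact: ler0n.
have pn := phi_gt0 n0.
have nT1 : T1 <= n%:R by lra.
have nT2 : T2 <= n%:R by lra.
have nT3 : T3 <= n%:R by lra.
pose s := 2 * K * phi n%:R.
have s_gt0 : 0 < s by rewrite mulr_gt0.
have s_le : s <= s0.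
  by have := small1 _ nT2; rewrite ltr_pdivlMr// /s mulrC => /ltW.
have a_ge0 k : 0 <= a k.
  by rewrite aE; case: ifP => // _; rewrite mulr_ge0 ?invr_ge0 ?sqrtr_ge0.
have asum : \sum_(n <= k < M) a k <= 15 * C * (phi s^-1 / Num.sqrt s).
  apply: le_trans (dy s M _); last by rewrite s_gt0.
  have [nM|/ltnW Mn] := leqP n M; last first.
    by rewrite big_geq// sumr_ge0// => k _; rewrite mulr_ge0 ?invr_ge0 ?sqrtr_ge0.
  rewrite [leRHS](big_cat_nat (n := n))//= -[leLHS]add0r lerD//.
    by apply: sumr_ge0 => k _; rewrite mulr_ge0 ?invr_ge0 ?sqrtr_ge0.
  rewrite [leRHS]big_mkcond/= big_nat_cond [leRHS]big_nat_cond.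
  apply: ler_sum => k /andP[/andP[nk _] _]; rewrite aE.
  case: ifP => //= vk0; rewrite (_ : v k < s)//.
  have /andP[_ h] := vK k; apply: (le_lt_trans h); rewrite /s -mulrA mulr_natl mulr2n.
  have : phi k%:R <= phi n%:R by apply: phi_decr; rewrite ?ler_nat.
  by move=> h2; apply: (@le_lt_trans _ _ (K * phi n%:R)); rewrite ?ler_pM2l// ltrDl mulr_gt0.
apply: (le_trans asum).
rewrite -!mulrA ler_wpM2l//; rewrite ler_wpM2l//.
have sinv : s^-1 = (2 * K)^-1 * (phi n%:R)^-1 by rewrite /s invfM.
have r1 : phi s^-1 <= c2 * phi (phi n%:R)^-1.
  have Tp : T <= (phi n%:R)^-1.
    by rewrite -[T]invrK lef_pV2 ?posrE ?invr_gt0//; exact/ltW/small2.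
  by have [+ _] := ratio _ Tp; rewrite sinv invrK.
have r2 := comp _ nT1.
have ss : Num.sqrt s = Num.sqrt (2 * K) * Num.sqrt (phi n%:R) by rewrite /s sqrtrM// ltW.
have sK0 : 0 < Num.sqrt (2 * K) by rewrite sqrtr_gt0.
have sp0 : 0 < Num.sqrt (phi n%:R) by rewrite sqrtr_gt0.
have c20 : 0 < c2 by rewrite /c2 !mulr_gt0.
apply: (@le_trans _ _ (c2 * (c1 * n%:R * phi n%:R ^+ 2) / Num.sqrt s)).
  rewrite ler_pM2r ?invr_gt0 ?sqrtr_gt0//; apply: (le_trans r1).
  by rewrite ler_pM2l.
rewrite ss.
have pE : phi n%:R = Num.sqrt (phi n%:R) ^+ 2 by rewrite sqr_sqrtr// ltW.
rewrite le_eqVlt; apply/orP; left; apply/eqP.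
move: (Num.sqrt (phi n%:R)) sp0 pE => r r0 ->.
by rewrite /c2; field; rewrite !gt_eqF.
Qed.

(** Comparing the index [m = 2 n - 1] with the tail from [n] cancels the factor [n]:
    [n * l (2 n - 1) <= c n (phi n)^(3/2)]. Regular variation replaces [phi n] by
    [phi j] for the indices [j] next to [2 n], as [j <= 3 n]. *)
Lemma decay_of_tail (a l : nat -> R) c N : 0 <= c -> (0 < N)%N ->
  (forall n, (N <= n)%N ->
    tail_bounded a n (c * n%:R * (phi n%:R * Num.sqrt (phi n%:R)))) ->
  (forall k, 0 <= l k) -> nonincreasing_seq l ->
  (forall n m tau, 0 <= tau -> tail_bounded a n tau -> l m * (m.+1%:R - n%:R) <= tau) ->
  exists D N', forall j, (N' <= j)%N -> l j <= D * (phi j%:R * Num.sqrt (phi j%:R)).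
Proof.
move=> c0 N0 tail l0 l_decr lbound.
have [T T0 ratio] := rv_ratio phi_gt0 phi_rv (ltr0Sn R 2).
exists (c * (6 * Num.sqrt 6)), (2 * (N + Num.bound T).+1)%N => j jN.
pose n := j./2.
have nN : (N + Num.bound T < n)%N by rewrite /n -ltnS; lia.
have jn : (n.*2 <= j <= n.*2.+1)%N by rewrite /n; lia.
have n0 : (0 < n)%N by lia.
have nT : T <= n%:R.
  apply: (@le_trans _ _ (Num.bound T)%:R); first by rewrite ltW// archi_boundP// ltW.
  by rewrite ler_nat; lia.
have pn : 0 < phi n%:R by apply: phi_gt0.
have pj : 0 < phi j%:R by apply: phi_gt0.
have np : 0 < n%:R :> R by rewrite ltr0n.
have l2n : l j <= c * (phi n%:R * Num.sqrt (phi n%:R)).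
  have t0 : 0 <= c * n%:R * (phi n%:R * Num.sqrt (phi n%:R)).
    by rewrite mulr_ge0 ?mulr_ge0 ?sqrtr_ge0 ?(ltW pn) ?(ltW np).
  have nN' : (N <= n)%N by lia.
  have := lbound n (n.*2.-1) _ t0 (tail n nN').
  rewrite prednK; last by rewrite double_gt0.
  rewrite -natrB; last by lia.
  rewrite -addnn addnK => h.
  apply: (@le_trans _ _ (l (n + n).-1)); first by apply: l_decr; lia.
  by rewrite -(ler_pM2r np) (le_trans h)// mulrAC.
have phinj : phi n%:R <= 6 * phi j%:R.
  have [_ h] := ratio _ nT; apply: (le_trans h).
  rewrite (_ : 2 * 3 = 6 :> R); last by ring.
  rewrite ler_pM2l//; apply: phi_decr => //.
  by rewrite -natrM ler_nat; lia.
have sq : Num.sqrt (phi n%:R) <= Num.sqrt 6 * Num.sqrt (phi j%:R).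
  by rewrite -sqrtrM// ler_wsqrtr.
apply: (le_trans l2n); rewrite -mulrA ler_wpM2l// mulrACA.
by apply: ler_pM => //; exact: ltW.
Qed.

(** The exponent [4 / (4 - 1)] is kept in the form in which it arises as the exponent
    conjugate to [4]; [sqrt] passes from [B^* B] to the modulus of [B]. *)
Lemma powR_two_thirds (p x D : R) : 0 < p -> 0 <= x -> 0 <= D ->
  x <= D * (p * Num.sqrt p) ->
  Num.sqrt x `^ (4 / (4 - 1)) <= D `^ (2^-1 * (4 / (4 - 1))) * p.
Proof.
move=> p0 x0 D0 xD; rewrite -powR12_sqrt// -powRrM.
have -> : (4 - 1 : R) = 3 by ring.
have r0 : 0 <= 2^-1 * (4 / 3) :> R by rewrite mulr_ge0// divr_ge0.
have -> : D `^ (2^-1 * (4 / 3)) * p = (D * (p * Num.sqrt p)) `^ (2^-1 * (4 / 3)).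
  have pp : p * Num.sqrt p = p `^ (1 + 2^-1).
    by rewrite powRD ?gt_eqF ?implybT// powRr1 ?(ltW p0)// powR12_sqrt// ltW.
  rewrite pp [RHS]powRM ?powR_ge0// -powRrM (_ : (1 + 2^-1) * _ = 1) ?powRr1 ?(ltW p0)//.
  by field.
by apply: ge0_ler_powR; rewrite ?nnegrE// mulr_ge0 ?mulr_ge0 ?sqrtr_ge0 ?(ltW p0).
Qed.

End Decay.

(** * From spectral to weak modulation *)

Section Modulation.
Context {R : realType} {H : completeNormedModType R[i]}.
Variable ip : {dot H for @Num.conj R[i]}.
Hypothesis ip_norm : inner_product_norm ip.

(** The kernel of [V] is orthogonal to its dense range. *)
Lemma strictly_positive_injective (V : {linear H -> H}) x :
  strictly_positive ip V -> V x = 0 -> x = 0.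
Proof.
move=> [_ V_pos V_dense] Vx; apply: rnorm_small => eps eps0.
have [||z [/= xy [y _ yE]]] := V_dense [set y | rnorm (x - y) < eps].
- by exists x; rewrite /= subrr rnorm0.
- rewrite openE => y /= xy; apply/nbhs_ballP.
  exists (eps - rnorm (x - y))%:C; first by rewrite /= (_ : 0 = 0%:C)// ltcR subr_gt0.
  move=> z; rewrite -ball_normE/= rnormE ltcR ltrBrDr addrC => yz.
  by apply: le_lt_trans yz; have := ler_rnormD (x - y) (y - z); rewrite addrA subrK.
have [->|x0] := eqVneq x 0; first by rewrite rnorm0 ltW.
have n0 : 0 < rnorm x.
  by rewrite lt_neqAle rnorm_ge0 andbT eq_sym; apply: contra_neq x0; exact: rnorm_eq0.
have : rnorm x ^+ 2 <= rnorm x * rnorm (x - V y).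
  have -> : rnorm x ^+ 2 = complex.Re (ip x (x - V y)).
    by rewrite ipBr -(positive_op_selfadjoint V_pos) Vx ip0l subr0 (ip_rnorm ip_norm).
  exact: le_trans (ler_Re_rnorm _) (cauchy_schwarz ip_norm _ _).
by rewrite expr2 ler_pM2l// yE => h; apply: (le_trans h); exact: ltW.
Qed.

(** The orthonormal basis in the Hilbert-Schmidt norm is taken to be an eigenbasis
    of [V]; [E `[0, t^-1]] fixes the eigenvectors with eigenvalue below [t^-1]. *)
Lemma spectrally_modulated_eigenbasis (phi : R -> R) (V G : {linear H -> H}) e (v : nat -> R) :
  (forall t, 0 <= t -> 0 < phi t) -> strictly_positive ip V ->
  orthosystem ip e -> (forall k, 0 <= v k /\ (0 < v k -> ip (e k) (e k) = 1)) ->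
  diag_op ip e v V -> spectrally_modulated ip phi V G ->
  exists2 C, 0 <= C & forall t M, 0 < t ->
    \sum_(0 <= k < M | 0 < v k < t^-1) rnorm (G (e k)) ^+ 2 <= C * phi t.
Proof.
move=> phi_gt0 Vs eo ve eV [E [pvm V_int] Esup].
have V_pos : positive_op ip V by case: Vs.
set Z := [set _ | t in _] in Esup.
have [c c0 cZ] : exists2 c : R, 0 <= c & forall z, Z z -> (z <= c%:E)%E.
  move: Esup; case ZE : (ereal_sup Z) => [r| |]// _.
    exists (Num.max r 0); first by rewrite le_max lexx orbT.
    move=> z Zz; apply: (le_trans (ereal_sup_ubound Zz)).
    by rewrite ZE lee_fin le_max lexx.
  exists 0 => // z Zz; apply: (le_trans (ereal_sup_ubound Zz)); by rewrite ZE leNye.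
exists (c ^+ 2); first exact: sqr_ge0.
move=> t M t0; have pt := phi_gt0 t (ltW t0).
have spt : 0 < Num.sqrt (phi t) by rewrite sqrtr_gt0.
pose A := (G \o E `[0%R, (t^-1)%R]%classic : H -> H).
have hs : (hs_norm ip A <= (c * Num.sqrt (phi t))%:E)%E.
  have := cZ _ (ex_intro2 _ _ t (_ : (`]0, +oo[%classic : set R) t) erefl).
  rewrite lee_pdivrMr// EFinM; apply.
  by rewrite /= in_itv/= andbT.
pose P k := 0 < v k.
pose Bs := e @` [set k | P k].
have einj : set_inj [set k | P k] e.
  move=> j k /set_mem Pj /set_mem Pk ejk; apply/eqP; apply: contraT => /eqP jk.
  have := eo.1 j k jk; rewrite -ejk (ve j).2// => /eqP; by rewrite oner_eq0.
have e0 k : ~~ P k -> e k = 0.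
  rewrite /P -leNgt => vk0; apply: (strictly_positive_injective Vs).
  rewrite (diag_op_eigen _ eo eV) (_ : v k = 0) ?scale0r//.
  by apply/le_anti; rewrite vk0 (ve k).1.
have onb : orthonormal_basis ip Bs.
  split.
  - by move=> _ [k Pk <-]; exact: (ve k).2.
  - by move=> _ _ [j _ <-] [k _ <-] ejk; apply: eo.1 => jk; apply: ejk; rewrite jk.
  - move=> x xB; apply: (strictly_positive_injective Vs).
    apply: (cvg_uniqueH (eV x)); apply: cvg_near_cst; apply: nearW => n.
    rewrite /series/= big1// => k _; have [Pk|/e0 ->] := boolP (P k); last by rewrite !scaler0.
    by rewrite xB ?scale0r//; exists k.
have hsB : (sqrte (\esum_(x in Bs) (complex.Re `|A x| ^+ 2)%:E) <= (c * Num.sqrt (phi t))%:E)%E.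
  by apply: le_trans hs; apply: ereal_sup_ubound; exists Bs.
have cs0 : 0 <= c * Num.sqrt (phi t) by rewrite mulr_ge0 ?sqrtr_ge0.
have es : (\esum_(x in Bs) (complex.Re `|A x| ^+ 2)%:E <= (c ^+ 2 * phi t)%:E)%E.
  have -> : (c ^+ 2 * phi t)%:E = ((c * Num.sqrt (phi t))%:E ^+ 2)%E.
    by rewrite -EFin_expe exprMn sqr_sqrtr// ltW.
  rewrite -(@lee_sqrt R) ?sqrte_sqr ?gee0_abs ?lee_fin//.
  exact: mulr_ge0.
have sumE : (\esum_(x in Bs) (complex.Re `|A x| ^+ 2)%:E =
    \sum_(0 <= k <oo | P k) (rnorm (A (e k)) ^+ 2)%:E)%E.
  by apply: esum_pred_image => // k _; rewrite lee_fin sqr_ge0.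
rewrite -lee_fin; apply: le_trans es; rewrite sumE -sumEFin.
apply: (@le_trans _ _ (\sum_(0 <= k < M | P k) (rnorm (A (e k)) ^+ 2)%:E)%E); last first.
  by apply: nneseries_lim_ge => k _ _; rewrite lee_fin sqr_ge0.
rewrite big_mkcond [leRHS]big_mkcond/=; apply: lee_sum => k _; rewrite /P.
have [vk0|vk0] := ltP 0 (v k) => //=.
case: ifP => vt; last by rewrite lee_fin sqr_ge0.
rewrite /A /= (spectral_subspace_eigenvector ip_norm pvm V_pos V_int (v := v k))//.
  exact: diag_op_eigen eV.
by rewrite vk0 vt.
Qed.

End Modulation.

Section Quotient.
Context {R : realType} {H : completeNormedModType R[i]}.
Variable ip : {dot H for @Num.conj R[i]}.
Hypothesis ip_norm : inner_product_norm ip.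
Variable phi : R -> R.
Hypothesis phi_gt0 : forall t, 0 <= t -> 0 < phi t.
Hypothesis phi_decr : forall s t, 0 <= s -> s <= t -> phi t <= phi s.
Hypothesis phi_rv : regularly_varying (-1) phi.

(** [B^* B] is compact and positive, hence diagonal with eigenvalues [l k] on some [f];
    then [|B|] is diagonal with eigenvalues [sqrt (l k)], and [|B|^(4/3)] with
    eigenvalues [(l k)^(2/3)], which are [O(phi k)] by the tail estimate for [g]. *)
Lemma hilbert_schmidt_in_Lpow e g (B : {linear H -> H}) M c N :
  orthosystem ip e -> (forall k, e k = 0 -> g k = 0) ->
  (forall n, \sum_(0 <= k < n) rnorm (g k) ^+ 2 <= M) -> series_op ip e g B ->
  0 <= c -> (0 < N)%N ->
  (forall n, (N <= n)%N -> tail_bounded (fun k => rnorm (g k) ^+ 2) n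
     (c * n%:R * (phi n%:R * Num.sqrt (phi n%:R)))) ->
  in_Lpow ip phi (4 / (4 - 1))%:E B.
Proof.
move=> eo g0 gM eB c0 N0 tail.
have gB := bessel_square_summable gM.
have eb := orthosystem_bessel ip_norm eo.
have B_bounded := series_op_bounded ip_norm eb gB eB.
have [Bt gBt] := series_op_exists ip_norm gB eb.
have Bt_bounded := series_op_bounded ip_norm gB eb gBt.
have BBt := series_op_adjoint ip_norm eB gBt.
have eS := series_op_comp Bt_bounded eB.
pose S : {linear H -> H} := Bt \o B.
have SE x : Bt (B x) = S x by [].
have S_pos : positive_op ip S.
  move=> x; have -> : ip (S x) x = (rnorm (B x) ^+ 2)%:C.
    by rewrite -SE ipC -BBt (ip_rnorm ip_norm) cjR.
  by rewrite ler0c sqr_ge0.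
have S_bounded : bounded_op S.
  have [M1 M10 B1] := bounded_opP B_bounded; have [M2 M20 B2] := bounded_opP Bt_bounded.
  apply: (@bounded_op_of _ _ _ (M2 * M1)) => x; rewrite -SE -mulrA.
  by apply: (le_trans (B2 _)); rewrite ler_wpM2l.
have S_compact : compact_op S.
  apply: (series_op_compact ip_norm eb _ eS) => eps eps0.
  have [M1 M10 B1] := bounded_opP Bt_bounded.
  have M1pos : 0 < M1 ^+ 2 + 1 by rewrite ltr_wpDl// sqr_ge0.
  have d0 : 0 < eps / (M1 ^+ 2 + 1) by rewrite divr_gt0.
  have := square_summable_cauchy (fun k => sqr_ge0 (rnorm (g k))) gM d0.
  move=> [[P Q]/= [[N1 _ hP] [N2 _ hQ]] hPQ].
  exists (maxn N1 N2); apply: bessel_square_summable => n.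
  have [nN|Nn] := leqP n (maxn N1 N2).
    rewrite big_nat_cond big1 ?ltW// => k /andP[/andP[_ kn] _].
    by rewrite (leq_trans kn nN) rnorm0 expr0n.
  rewrite (big_cat_nat (n := maxn N1 N2))//=; last exact: ltnW.
  rewrite big_nat_cond big1 ?add0r; last by move=> k /andP[/andP[_ ->] _]; rewrite rnorm0 expr0n.
  apply: (@le_trans _ _ (M1 ^+ 2 * \sum_(maxn N1 N2 <= k < n) rnorm (g k) ^+ 2)).
    rewrite mulr_sumr; apply: ler_sum => k _; case: ifP => _.
      by rewrite rnorm0 expr0n mulr_ge0 ?sqr_ge0.
    by rewrite -exprMn ler_sqr ?nnegrE ?mulr_ge0 ?rnorm_ge0//=.
  have hs : \sum_(maxn N1 N2 <= k < n) rnorm (g k) ^+ 2 < eps / (M1 ^+ 2 + 1).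
    apply: (hPQ (maxn N1 N2, n)); split; [apply: hP|apply: hQ] => /=.
      exact: leq_maxl.
    exact: leq_trans (leq_maxr _ _) (ltnW Nn).
  have s0 : 0 <= \sum_(maxn N1 N2 <= k < n) rnorm (g k) ^+ 2.
    by apply: sumr_ge0 => k _; exact: sqr_ge0.
  move: hs; rewrite ltr_pdivlMr// => /ltW; apply: le_trans.
  by rewrite mulrC ler_wpM2l// lerDl.
have [f [l [fo lf l_decr l_cvg fS]]] :=
  compact_positive_diagonal ip_norm S_pos S_bounded S_compact.
have l0 k : 0 <= l k by have [] := lf k.
have bound n m tau : 0 <= tau -> tail_bounded (fun k => rnorm (g k) ^+ 2) n tau ->
    l m * (m.+1%:R - n%:R) <= tau.
  move=> tau0 gtau.
  exact: (singular_value_tail_bound ip_norm m eo g0 eB BBt fo lf l_decr fS SE tau0 gtau).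
have [D [N' decay]] := decay_of_tail phi_gt0 phi_decr phi_rv c0 N0 tail l0 l_decr bound.
pose r : R := 4 / (4 - 1).
have r_gt0 : 0 < r by rewrite divr_gt0// subr_gt0 ltr1n.
pose t k := Num.sqrt (l k); pose p k := t k `^ r.
have t0 k : 0 <= t k by exact: sqrtr_ge0.
have t_le k : 0 <= t k <= t 0%N by rewrite t0 ler_wsqrtr// l_decr.
have p_le k : 0 <= p k <= p 0%N.
  rewrite powR_ge0; apply: ge0_ler_powR; rewrite ?nnegrE ?(ltW r_gt0)//.
  by case/andP: (t_le k).
have [T fT _] : exists2 T : {linear H -> H}, diag_op ip f t T & bounded_op T.
  by apply: (@diag_op_exists _ _ ip ip_norm f t (t 0%N)) => // k; rewrite ger0_norm; case/andP: (t_le k).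
have [P fP P_bounded] : exists2 P : {linear H -> H}, diag_op ip f p P & bounded_op P.
  by apply: (@diag_op_exists _ _ ip ip_norm f p (p 0%N)) => // k; rewrite ger0_norm; case/andP: (p_le k).
have p_decay j : (N' <= j)%N -> p j <= `|D| `^ (2^-1 * r) * phi j%:R.
  move=> jN; apply: powR_two_thirds => //; first exact: phi_gt0.
  apply: (le_trans (decay j jN)); rewrite ler_wpM2r ?ler_norm// mulr_ge0 ?sqrtr_ge0//.
  exact/ltW/phi_gt0.
have p_decr : nonincreasing_seq p.
  move=> i j ij; apply: ge0_ler_powR; rewrite ?nnegrE ?(ltW r_gt0)//.
  by rewrite ler_wsqrtr// l_decr.
have p_cvg : p @ \oo --> 0.
  apply/cvgrPdist_lt => eps eps0.
  have D0 : 0 < `|D| `^ (2^-1 * r) + 1 by rewrite ltr_wpDl// powR_ge0.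
  have d0 : 0 < eps / (`|D| `^ (2^-1 * r) + 1) by rewrite divr_gt0.
  have [T1 T10 small] := rv_vanish phi_gt0 phi_decr phi_rv d0.
  exists (maxn N' (Num.bound T1)) => // j /= jN.
  have jT : T1 <= j%:R.
    apply: (@le_trans _ _ (Num.bound T1)%:R); first by rewrite ltW// archi_boundP// ltW.
    by rewrite ler_nat; lia.
  have jN' : (N' <= j)%N by lia.
  rewrite sub0r normrN ger0_norm ?powR_ge0//.
  have := small _ jT; rewrite ltr_pdivlMr//; apply: le_lt_trans.
  apply: (le_trans (p_decay j jN')); rewrite mulrC ler_wpM2l ?lerDl//.
  exact/ltW/phi_gt0.
have pf k : 0 <= p k /\ (0 < p k -> ip (f k) (f k) = 1).
  split; first exact: powR_ge0.
  have [_ lk] := lf k; move=> pk; apply: lk; rewrite lt_neqAle l0 andbT eq_sym.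
  apply/negP => /eqP lk0; move: pk.
  by rewrite /p /t lk0 sqrtr0 powR0 ?ltxx// gt_eqF.
split=> //; exists T, P; split.
- apply: (diag_op_modulus ip_norm fo t_le fT BBt _ SE).
  by rewrite (_ : (fun k => t k ^+ 2) = l)//; apply/funext => k; rewrite sqr_sqrtr.
- exact: (diag_op_power ip_norm fo r_gt0 t_le fT fP).
- split; first exact: (diag_op_compact ip_norm fo p_cvg fP).
  exists p; first exact: (diag_op_singular_values ip_norm fo pf p_decr p_cvg fP).
  pose D' := `|D| `^ (2^-1 * r); pose D2 := \sum_(0 <= j < N') p j / phi j%:R.
  exists (D' + D2) => _ [j _ <-].
  have pj0 : 0 < phi j%:R by exact: phi_gt0.
  have D20 : 0 <= D2.
    by apply: sumr_ge0 => i _; rewrite divr_ge0 ?powR_ge0 ?ltW ?phi_gt0.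
  have [jN|Nj] := ltnP j N'; last first.
    rewrite ler_pdivrMr//; apply: (le_trans (p_decay j Nj)).
    by rewrite ler_pM2r// lerDl.
  apply: (@le_trans _ _ D2); last by rewrite lerDr powR_ge0.
  rewrite /D2 (big_rem j)/= ?mem_index_iota ?jN// lerDl.
  by apply: sumr_ge0 => i _; rewrite divr_ge0 ?powR_ge0 ?ltW ?phi_gt0.
Qed.

End Quotient.

Theorem lemma4p9 (R : realType) (H : completeNormedModType R[i])
    (ip : {dot H for @Num.conj R[i]})
    (ip_norm : inner_product_norm ip)
    (H_separable : separable_space H)
    (phi : R -> R)
    (phi_gt0 : forall t : R, 0 <= t -> 0 < phi t)
    (phi_decr : forall s t : R, 0 <= s -> s <= t -> phi t <= phi s)
    (phi_rv : regularly_varying (-1) phi)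
    (phi_invertible : invertible_near0 phi)
    (phi_W1 : property_W1 phi)
    (V : {linear H -> H})
    (V_pos : strictly_positive ip V)
    (V_L : in_L ip phi V)
    (G : {linear H -> H})
    (G_bounded : bounded_op G) :
  spectrally_modulated ip phi V G -> weakly_modulated ip phi V G.
Proof.
move=> G_mod; have [V_bounded V_ge0 _] := V_pos; have [V_compact [s Vs [K0 sK0]]] := V_L.
have [e [v [eo ve v_decr v_cvg eV]]] :=
  compact_positive_diagonal ip_norm V_ge0 V_bounded V_compact.
have v0 k : 0 <= v k by have [] := ve k.
pose K := Num.max K0 1.
have K_gt0 : 0 < K by rewrite lt_max ltr01 orbT.
have vK k : 0 <= v k <= K * phi k%:R.
  rewrite v0; apply: (le_trans (eigenvalue_le_singular_value ip_norm eo ve v_decr v_cvg eV Vs k)).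
  rewrite -ler_pdivrMr ?phi_gt0//; apply: (@le_trans _ _ K0); last by rewrite le_max lexx.
  by apply: sK0; exists k.
have [C C0 G_tail] := spectrally_modulated_eigenbasis ip_norm phi_gt0 V_pos eo ve eV G_mod.
have e_zero k : v k = 0 -> e k = 0.
  move=> vk; apply: (strictly_positive_injective ip_norm V_pos).
  by rewrite (diag_op_eigen _ eo eV) vk scale0r.
pose r : R := 4^-1.
have r0 : 0 < r by rewrite invr_gt0.
(* [g k] is the value at [e k] of [G V^(-1/4)]; it is [0] when [e k = 0]. *)
pose g k := (v k `^ r)^-1%:C *: G (e k).
have g_zero k : e k = 0 -> g k = 0 by move=> ek; rewrite /g ek linear0 scaler0.
have gE k : rnorm (g k) ^+ 2 =
    if 0 < v k then (Num.sqrt (v k))^-1 * rnorm (G (e k)) ^+ 2 else 0.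
  case: ifP => vk; last first.
    have vk0 : v k = 0 by apply/le_anti; rewrite v0 leNgt vk.
    by rewrite g_zero ?e_zero// rnorm0 expr0n.
  rewrite /g rnormZ rnormR exprMn; congr (_ * _).
  rewrite ger0_norm ?invr_ge0 ?powR_ge0// exprVn; congr (_^-1).
  by rewrite -powR_mulrn ?powR_ge0// -powRrM -powR12_sqrt//; congr (_ `^ _); rewrite /r; field.
have [c c0 [N N0 g_tail]] := weighted_tail phi_gt0 phi_decr phi_rv phi_invertible phi_W1
  C0 K_gt0 vK (fun k => sqr_ge0 (rnorm (G (e k)))) gE G_tail.
have [M gM] : exists M, forall n, \sum_(0 <= k < n) rnorm (g k) ^+ 2 <= M.
  exists (\sum_(0 <= k < N) rnorm (g k) ^+ 2 +
    c * N%:R * (phi N%:R * Num.sqrt (phi N%:R))) => n.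
  have cN0 : 0 <= c * N%:R * (phi N%:R * Num.sqrt (phi N%:R)).
    by rewrite !mulr_ge0 ?sqrtr_ge0// ltW ?phi_gt0.
  have sum0 a b : 0 <= \sum_(a <= k < b) rnorm (g k) ^+ 2.
    by apply: sumr_ge0 => k _; exact: sqr_ge0.
  have [nN|Nn] := leqP n N.
    by rewrite [X in _ <= X + _](big_cat_nat (n := n))//= -addrA lerDl addr_ge0.
  rewrite [leLHS](big_cat_nat (leq0n N) (ltnW Nn)) lerD2l.
  exact: (g_tail N (leqnn N) n).
have gB := bessel_square_summable gM.
have eb := orthosystem_bessel ip_norm eo.
have [B eB] := series_op_exists ip_norm eb gB.
have B_bounded := series_op_bounded ip_norm eb gB eB.
have v_le k : 0 <= v k <= v 0%N by rewrite v0 v_decr.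
have [W eW _] : exists2 W : {linear H -> H}, diag_op ip e (fun k => v k `^ r) W & bounded_op W.
  apply: (diag_op_exists (C := v 0%N `^ r) ip_norm eo) => k.
  rewrite ger0_norm ?powR_ge0//; apply: ge0_ler_powR; rewrite ?nnegrE ?(ltW r0)//.
  exact: v_decr.
have unit_bound (k : nat) : `|1 : R| <= 1 by rewrite normr1.
have [Q eQ _] := diag_op_exists (a := fun=> 1) (C := 1) ip_norm eo unit_bound.
(* Any [p > 2] would do: the sum over [v k < s] of [v k `^ (- 2 / p) * |G (e k)|^2] is
   then governed by the indices for which [v k] is comparable to [s]. *)
exists 4; first by rewrite ler1n.
exists W, B; split.
- exact: (diag_op_power ip_norm eo r0 v_le eV eW).
- move=> x _ <-.
  (* [V] is injective and [V \o Q = V], so the eigenbasis is complete. *)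
  have Qx : Q x = x.
    apply/subr0_eq/(strictly_positive_injective ip_norm V_pos); rewrite raddfB/=.
    apply/eqP; rewrite subr_eq0; apply/eqP.
    have := diag_op_comp ip_norm eo eV eQ.
    under [X in diag_op _ _ X]eq_fun do rewrite mulr1.
    by move=> h; exact: series_op_unique h eV x.
  have BW := series_op_comp B_bounded eW; have GQ := series_op_comp G_bounded eQ.
  have hE : B \o (fun k => (v k `^ r)%:C *: e k) = G \o (fun k => 1%:C *: e k).
    apply/funext => k /=; rewrite linearZ/= scale1r (series_op_apply eo eB (g_zero k)) /g scalerA.
    have [vk|vk] := eqVneq (v k) 0; first by rewrite e_zero// linear0 scaler0.
    by rewrite -rcM divff ?scale1r// gt_eqF// powR_gt0// lt_neqAle eq_sym vk v0.
  rewrite hE in BW; rewrite -{2}Qx; exact: (series_op_unique BW GQ x).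
- rewrite /conjugate_exponent (eqr_nat R 4 1)/=.
  exact: (hilbert_schmidt_in_Lpow ip_norm phi_gt0 phi_decr phi_rv eo g_zero gM eB c0 N0 g_tail).
Qed.
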